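(* For every $r>1$, let $d=\frac12(r+1)$ and let $Q_r\in\mathbb{C}\oplus\{0\}\oplus M_2\big(C[1,d]\big)$ be the idempotent $$Q_r=1\oplus 0\oplus\begin{pmatrix}D_0&-\ell(D_0)\\\ell(D_0)&I_0-D_0\end{pmatrix},$$ where $I_0,D_0,\ell(D_0)\in C[1,d]$ are given by $I_0(t)=1$, $D_0(t)=t$, $\ell(D_0)(t)=\sqrt{t(t-1)}$ for $t\in[1,d]$. Then $Q_r$ is a universal $r$-idempotent.
   Context: An idempotent $Q$ in a $C^*$-algebra satisfies $Q^2=Q$; a projection is a self-adjoint idempotent; a non-projection idempotent is an idempotent that is not a projection. $C^*\{Q\}$ is the $C^*$-algebra generated by $Q$ alone (not assumed to contain a unit of the ambient algebra). $C[1,d]$ is the $C^*$-algebra of complex-valued continuous functions on $[1,d]$. Universal $r$-idempotent ($r>1$): a non-projection idempotent $Q$ in a $C^*$-algebra such that $\|Q\|=r$ and for every non-projection idempotent $Q'$ in any $C^*$-algebra with $\|Q'\|\le r$ there is a $C^*$-algebra homomorphism ($*$-homomorphism) $\pi:C^*\{Q\}\to C^*\{Q'\}$ with $\pi(Q)=Q'$. *)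

(* Defs.v *)
From HB Require Import structures.
From mathcomp Require Import all_boot all_order all_algebra.
From mathcomp Require Import complex.
From mathcomp Require Import mathcomp_extra boolp classical_sets functions reals.
From mathcomp Require Import topology normedtype realfun.
From mathcomp Require Import ring lra.

Set Implicit Arguments.
Unset Strict Implicit.
Unset Printing Implicit Defensive.

Import Order.TTheory GRing.Theory Num.Theory.
Import Normc.
Import numFieldNormedType.Exports.

Local Notation Re := complex.Re.
Local Notation Im := complex.Im.

Local Open Scope classical_set_scope.
Local Open Scope complex_scope.
Local Open Scope ring_scope.

(* No unit is required, so the product is not the one of the library's (unital)
   rings; the norm is valued in R[i], as for every normed R[i]-module of the
   library (norms are the non-negative reals of R[i]). *)
HB.mixin Record isCstarAlgebra (R : realType) A
    & CompleteNormedModule R[i] A := {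
  cmul : A -> A -> A;
  star : A -> A;
  cmulA : associative cmul;
  cmulDl : left_distributive cmul +%R;
  cmulDr : right_distributive cmul +%R;
  cmulZl : forall (a : R[i]) x y, cmul (a *: x) y = a *: cmul x y;
  cmulZr : forall (a : R[i]) x y, cmul x (a *: y) = a *: cmul x y;
  starK : involutive star;
  starD : {morph star : x y / x + y};
  starZ : forall (a : R[i]) x, star (a *: x) = a^* *: star x;
  starM : forall x y, star (cmul x y) = cmul (star y) (star x);
  cnormM : forall x y, `|cmul x y| <= `|x| * `|y|;
  cnorm_star : forall x, `|cmul (star x) x| = `|x| ^+ 2
}.

#[short(type="cstarAlgType")]
HB.structure Definition CstarAlgebra (R : realType) :=
  {A of isCstarAlgebra R A & CompleteNormedModule R[i] A}.

Declare Scope cstar_scope.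
Delimit Scope cstar_scope with cstar.
Notation "x ** y" := (cmul x y) (at level 40, left associativity) : cstar_scope.
Notation "x ^**" := (star x) (at level 1, format "x ^**") : cstar_scope.
Local Open Scope cstar_scope.

Section Idempotents.
Variables (R : realType) (A : cstarAlgType R).

Definition idempotent_elt (Q : A) : Prop := Q ** Q = Q.

Definition projection (Q : A) : Prop := idempotent_elt Q /\ Q^** = Q.

Definition non_projection_idempotent (Q : A) : Prop :=
  idempotent_elt Q /\ ~ projection Q.

Definition cstar_subalgebra (S : set A) : Prop :=
  [/\ S 0,
      forall x y, S x -> S y -> S (x + y),
      forall (a : R[i]) x, S x -> S (a *: x),
      forall x y, S x -> S y -> S (x ** y) &
      forall x, S x -> S x^**] /\ closed S.

Definition cstar_generated (Q : A) : set A :=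
  smallest cstar_subalgebra [set Q].

Lemma cstar_generatedP (Q : A) : cstar_subalgebra (cstar_generated Q).
Proof.
split; last by apply: closed_bigI => S [[_ Sc] _].
split=> [S [[[]]]//|x y Sx Sy S SP|a x Sx S SP|x y Sx Sy S SP|x Sx S SP].
- by have [[[_ SD _ _ _] _] _] := SP; apply: SD; [exact: Sx|exact: Sy].
- by have [[[_ _ SZ _ _] _] _] := SP; apply: SZ; exact: Sx.
- by have [[[_ _ _ SM _] _] _] := SP; apply: SM; [exact: Sx|exact: Sy].
- by have [[[_ _ _ _ SS] _] _] := SP; apply: SS; exact: Sx.
Qed.

End Idempotents.

(* A *-homomorphism D -> E between C*-subalgebras, encoded as a map of the
   ambient algebras of which only the values on D matter. *)
Definition star_homomorphism (R : realType) (A B : cstarAlgType R)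
    (D : set A) (E : set B) (f : A -> B) : Prop :=
  [/\ set_fun D E f,
      {in D &, forall x y, f (x + y) = f x + f y},
      {in D, forall x, forall a : R[i], f (a *: x) = a *: f x},
      {in D &, forall x y, f (x ** y) = f x ** f y} &
      {in D, forall x, f x^** = (f x)^**}].

Definition universal_idempotent (R : realType) (r : R) (A : cstarAlgType R)
    (Q : A) : Prop :=
  [/\ non_projection_idempotent Q,
      `|Q| = r%:C &
      forall (B : cstarAlgType R) (Q' : B),
        non_projection_idempotent Q' -> `|Q'| <= r%:C ->
        exists pi : A -> B,
          star_homomorphism (cstar_generated Q) (cstar_generated Q') pi
          /\ pi Q = Q'].

Section ComplexNumbers.
Variable R : realType.
Local Notation C := R[i].

(* C^o cannot be made complete: the library already has a completeness instance
   keyed on the regular module, for real types. *)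
HB.instance Definition _ := NormedModule.copy C C^o.

Lemma normcR (z : R[i]) : `|z| = (normc z)%:C.
Proof. by case: z. Qed.

Lemma normc_ge0 (z : R[i]) : 0 <= normc z.
Proof. by case: z => a b; exact: sqrtr_ge0. Qed.

Lemma ler_real_complex (x y : R) : (x%:C <= y%:C) = (x <= y).
Proof. by rewrite lecE /= eqxx. Qed.

Lemma ltr_real_complex (x y : R) : (x%:C < y%:C) = (x < y).
Proof. by rewrite ltcE /= eqxx. Qed.

Lemma normc_Re_le (z : R[i]) : `|Re z| <= normc z.
Proof. by rewrite -ler_real_complex -normcR normc_ge_Re. Qed.

Lemma normc_Im_le (z : R[i]) : `|Im z| <= normc z.
Proof.
case: z => a b /=; rewrite -sqrtr_sqr ler_wsqrtr// lerDr; exact: sqr_ge0.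
Qed.

Lemma normc_le (z : R[i]) : normc z <= `|Re z| + `|Im z|.
Proof.
rewrite {1}[z]complexE; apply: le_trans (le_normcD _ _) _.
rewrite normcM /= !expr0n /= !addr0 !add0r expr1n sqrtr1 mul1r.
by rewrite !sqrtr_sqr.
Qed.

Lemma complex_complete (F : set_system C) :
  ProperFilter F -> cauchy F -> cvg F.
Proof.
move=> FF /cauchyP Fc.
have aux (p : R[i] -> R) :
    (forall x y, `|p x - p y| <= normc (x - y)) -> cvg (p @ F).
  move=> pl; apply: cauchy_cvg; apply/cauchyP => e e0.
  have eC : 0 < e%:C by rewrite ltr_real_complex.
  have [x Fx] := Fc _ eC; exists (p x).
  change (F (p @^-1` ball (p x) e)); apply: filterS Fx => y; rewrite /= -!ball_normE /ball_ /= => xy.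
  change (`|p x - p y| < e); apply: le_lt_trans (pl _ _) _; rewrite -ltr_real_complex -normcR.
  exact: xy.
have cRe := aux (@Re R) _; have cIm := aux (@Im R) _.
have {}cRe : cvg (@Re R @ F).
  by apply: cRe => -[a b] [c d]; exact: (normc_Re_le ((a +i* b) - (c +i* d))).
have {}cIm : cvg (@Im R @ F).
  by apply: cIm => -[a b] [c d]; exact: (normc_Im_le ((a +i* b) - (c +i* d))).
apply/cvg_ex; exists (lim (@Re R @ F) +i* lim (@Im R @ F)).
apply/(@cvgrPdist_le _ C) => /= e e0.
have eR : e = (Re e)%:C by rewrite RRe_real// gtr0_real.
have Re0 : 0 < Re e / 2 by rewrite divr_gt0// -ltr_real_complex -eR.
have /cvgrPdist_le/(_ _ Re0) H1 := cRe.
have /cvgrPdist_le/(_ _ Re0) H2 := cIm.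
near=> x.
rewrite eR normcR ler_real_complex (le_trans (normc_le _))//.
rewrite [Re e]splitr lerD//=.
  have -> : Re (lim (@Re R @ F) +i* lim (@Im R @ F) - x) =
            lim (@Re R @ F) - Re x by case: (x).
  by near: x.
have -> : Im (lim (@Re R @ F) +i* lim (@Im R @ F) - x) =
            lim (@Im R @ F) - Im x by case: (x).
by near: x.
Unshelve. all: by end_near. Qed.

HB.instance Definition _ := Uniform_isComplete.Build C complex_complete.

Let mulC (x y : C) : C := (x : R[i]) * y.
Let conjC (x : C) : C := (x : R[i])^*.

Let cmulA_C : associative mulC. Proof. exact: mulrA. Qed.
Let cmulDl_C : left_distributive mulC +%R. Proof. exact: mulrDl. Qed.
Let cmulDr_C : right_distributive mulC +%R. Proof. exact: mulrDr. Qed.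
Let cmulZl_C (a : R[i]) x y : mulC (a *: x) y = a *: mulC x y.
Proof. by rewrite /mulC -mulrA. Qed.
Let cmulZr_C (a : R[i]) x y : mulC x (a *: y) = a *: mulC x y.
Proof. exact: mulrCA. Qed.
Let starK_C : involutive conjC. Proof. exact: conjcK. Qed.
Let starD_C : {morph conjC : x y / x + y}. Proof. exact: (rmorphD conjc). Qed.
Let starZ_C (a : R[i]) x : conjC (a *: x) = a^* *: conjC x.
Proof. exact: (rmorphM conjc). Qed.
Let starM_C x y : conjC (mulC x y) = mulC (conjC y) (conjC x).
Proof. by rewrite /conjC /mulC [x * y]mulrC; exact: (rmorphM conjc). Qed.
Let cnormM_C x y : `|mulC x y| <= `|x| * `|y|.
Proof. by rewrite /mulC -normrM. Qed.
Let cnorm_star_C x : `|mulC (conjC x) x| = `|x| ^+ 2.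
Proof. by rewrite /mulC /conjC normrM normcJ expr2. Qed.

HB.instance Definition _ := isCstarAlgebra.Build R C
  cmulA_C cmulDl_C cmulDr_C cmulZl_C cmulZr_C
  starK_C starD_C starZ_C starM_C cnormM_C cnorm_star_C.

End ComplexNumbers.

Definition zero_algebra (R : realType) : Type := unit.

Section ZeroAlgebra.
Variable R : realType.
Local Notation Z := (zero_algebra R).

HB.instance Definition _ := Choice.copy Z unit.

Let zadd (x y : Z) : Z := tt.
Let zopp (x : Z) : Z := tt.
Let zadd0 : left_id (tt : Z) zadd. Proof. by case. Qed.
Let zscale (a : R[i]) (x : Z) : Z := tt.
Let zscale1 : left_id 1 zscale. Proof. by case. Qed.
Let zoppK : involutive zopp. Proof. by case. Qed.

HB.instance Definition _ := @GRing.isZmodule.Build Z tt zopp zadd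
  (fun _ _ _ => erefl) (fun _ _ => erefl)
  zadd0 (fun _ => erefl).

HB.instance Definition _ := @GRing.Zmodule_isLmodule.Build R[i] Z zscale
  (fun _ _ _ => erefl) zscale1
  (fun _ _ _ => erefl) (fun _ _ _ => erefl).

Let znorm (x : Z) : R[i] := 0.

Let znormD x y : znorm (x + y) <= znorm x + znorm y.
Proof. by rewrite /znorm addr0. Qed.
Let znormZ (a : R[i]) x : znorm (a *: x) = `|a| * znorm x.
Proof. by rewrite /znorm mulr0. Qed.
Let znorm0 x : znorm x = 0 -> x = 0.
Proof. by case: x. Qed.

HB.instance Definition _ := @Lmodule_isNormed.Build R[i] Z
  znorm znormD znormZ znorm0.

Let zcomplete (F : set_system Z) : ProperFilter F -> cauchy F -> cvg F.
Proof.
move=> FF _; apply/cvg_ex; exists (0 : Z) => A /nbhs_singleton A0.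
by apply: (@filterS _ F _ setT _ _ filterT) => -[].
Qed.

HB.instance Definition _ := Uniform_isComplete.Build Z zcomplete.

Let znorm_le (x y : Z) : `|x| <= `|y| * `|y|.
Proof. by rewrite /Num.Def.normr /= mulr0. Qed.
Let znorm_eq (x y : Z) : `|x| = `|y| ^+ 2.
Proof. by rewrite expr2 /Num.Def.normr /= mulr0. Qed.

HB.instance Definition _ := @isCstarAlgebra.Build R Z zadd zopp
  (fun _ _ _ => erefl) (fun _ _ _ => erefl) (fun _ _ _ => erefl)
  (fun _ _ _ => erefl) (fun _ _ _ => erefl)
  zoppK
  (fun _ _ => erefl) (fun _ _ => erefl) (fun _ _ => erefl)
  (fun x y => znorm_le _ _) (fun x => znorm_eq _ _).

End ZeroAlgebra.

HB.instance Definition _ (U V : pnbhsType) := Pointed.on (U * V)%type.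
HB.instance Definition _ (U V : ptopologicalType) :=
  Pointed.on (U * V)%type.
HB.instance Definition _ (U V : puniformType) :=
  Pointed.on (U * V)%type.

Section ProductComplete.
Variables U V : completeType.

Lemma prod_complete (F : set_system (U * V)) :
  ProperFilter F -> cauchy F -> cvg F.
Proof.
move=> FF Fc.
have c1 : cvg (fst @ F).
  apply: cauchy_cvg => A entA.
  have /Fc[[P Q] [FP FQ] PQ] := prod_entP entA (@entourageT V).
  exists (fst @` P, fst @` Q).
    by split; [apply: filterS FP | apply: filterS FQ] => x ?; exists x.
  by move=> -[_ _] /= [[x Px <-] [y Qy <-]]; have [] := PQ (x, y) (conj Px Qy).
have c2 : cvg (snd @ F).
  apply: cauchy_cvg => A entA.
  have /Fc[[P Q] [FP FQ] PQ] := prod_entP (@entourageT U) entA.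
  exists (snd @` P, snd @` Q).
    by split; [apply: filterS FP | apply: filterS FQ] => x ?; exists x.
  by move=> -[_ _] /= [[x Px <-] [y Qy <-]]; have [] := PQ (x, y) (conj Px Qy).
apply/cvg_ex; exists (lim (fst @ F), lim (snd @ F)).
move=> A /(cvg_pair c1 c2) FA.
by apply: (@filterS _ F _ _ _ _ FA) => -[].
Qed.

HB.instance Definition _ := Uniform_isComplete.Build (U * V)%type prod_complete.
End ProductComplete.

HB.instance Definition _ (K : numFieldType) (U V : completePseudoMetricType K) :=
  Complete.on (U * V)%type.
HB.instance Definition _ (K : numFieldType) (U V : completeNormedModType K) :=
  Complete.on (U * V)%type.

(* The library's norm on A * B is the maximum of the two norms. *)
Section DirectSum.
Variables (R : realType) (A B : cstarAlgType R).
Local Notation AB := (A * B)%type.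

Let dmul (x y : AB) : AB := (x.1 ** y.1, x.2 ** y.2).
Let dstar (x : AB) : AB := (x.1^**, x.2^**).

Let dmulA : associative dmul.
Proof. by move=> x y z; rewrite /dmul /= !cmulA. Qed.
Let dmulDl : left_distributive dmul +%R.
Proof. by move=> x y z; rewrite /dmul /= !cmulDl. Qed.
Let dmulDr : right_distributive dmul +%R.
Proof. by move=> x y z; rewrite /dmul /= !cmulDr. Qed.
Let dmulZl (a : R[i]) x y : dmul (a *: x) y = a *: dmul x y.
Proof. by rewrite /dmul /= !cmulZl. Qed.
Let dmulZr (a : R[i]) x y : dmul x (a *: y) = a *: dmul x y.
Proof. by rewrite /dmul /= !cmulZr. Qed.
Let dstarK : involutive dstar.
Proof. by case=> x y; rewrite /dstar /= !starK. Qed.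
Let dstarD : {morph dstar : x y / x + y}.
Proof. by move=> x y; rewrite /dstar /= !starD. Qed.
Let dstarZ (a : R[i]) x : dstar (a *: x) = a^* *: dstar x.
Proof. by rewrite /dstar /= !starZ. Qed.
Let dstarM x y : dstar (dmul x y) = dmul (dstar y) (dstar x).
Proof. by rewrite /dstar /= !starM. Qed.

Let max_ge (u v : R[i]) : u \is Num.real -> v \is Num.real ->
  u <= Num.max u v /\ v <= Num.max u v.
Proof. by move=> ur vr; rewrite !comparable_le_max ?real_comparable// !lexx orbT. Qed.

Let dnormE (x : AB) : `|x| = Num.max `|x.1| `|x.2|.
Proof. by []. Qed.

Let dnormM x y : `|dmul x y| <= `|x| * `|y|.
Proof.
have le1 (z : AB) : `|z.1| <= `|z| /\ `|z.2| <= `|z|.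
  by apply: max_ge; exact: normr_real.
have [x1 x2] := le1 x; have [y1 y2] := le1 y.
rewrite [leLHS]dnormE /Order.max; case: ifP => _ /=.
  by apply: le_trans (cnormM _ _) _; rewrite ler_pM.
by apply: le_trans (cnormM _ _) _; rewrite ler_pM.
Qed.

Let dnorm_star x : `|dmul (dstar x) x| = `|x| ^+ 2.
Proof.
rewrite !dnormE /= !cnorm_star /Order.max.
by rewrite ltr_pXn2r// ?nnegrE//; case: ifP.
Qed.

HB.instance Definition _ := isCstarAlgebra.Build R AB
  dmulA dmulDl dmulDr dmulZl dmulZr dstarK dstarD dstarZ dstarM
  dnormM dnorm_star.

End DirectSum.

Section EuclideanNorm.
Variable R : realType.
Local Notation C := R[i].

Definition l2norm n (v : 'cV[C]_n) : R :=
  Num.sqrt (\sum_i normc (v i 0) ^+ 2).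

Definition adjmx n (M : 'M[C]_n) : 'M[C]_n := map_mx conjc M^T.

Definition opnorm n (M : 'M[C]_n) : R :=
  sup [set l2norm (M *m v) | v in [set v : 'cV[C]_n | l2norm v <= 1]].

Lemma cauchy_schwarz_sum (I : finType) (f g : I -> R) :
  (\sum_i f i * g i) ^+ 2 <= (\sum_i f i ^+ 2) * (\sum_i g i ^+ 2).
Proof.
set X := \sum_i f i ^+ 2; set Y := \sum_i g i ^+ 2; set S := \sum_i _.
have [X0|X0] := eqVneq X 0.
  have f0 i : f i = 0.
    have /eqP := X0; rewrite psumr_eq0; last by move=> *; exact: sqr_ge0.
    by move=> /allP/(_ i)/[!mem_index_enum]/(_ isT)/=; rewrite sqrf_eq0 => /eqP.
  rewrite /S big1 ?expr0n ?X0 ?mul0r// => i _; by rewrite f0 mul0r.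
have Xp : 0 < X by rewrite lt_def X0 sumr_ge0// => i _; exact: sqr_ge0.
rewrite -subr_ge0 -(pmulr_rge0 _ Xp).
have : 0 <= \sum_i (X * g i - S * f i) ^+ 2.
  by apply: sumr_ge0 => i _; exact: sqr_ge0.
congr (_ <= _).
under eq_bigr => i _.
  rewrite (_ : _ ^+ 2 = X ^+ 2 * g i ^+ 2 - (X * S *+ 2) * (f i * g i)
    + S ^+ 2 * f i ^+ 2); last by ring.
  over.
by rewrite !big_split /= sumrN -!mulr_sumr -/X -/Y -/S; ring.
Qed.

Lemma l2norm_ge0 n (v : 'cV[C]_n) : 0 <= l2norm v.
Proof. exact: sqrtr_ge0. Qed.

Lemma l2norm_sqr n (v : 'cV[C]_n) :
  l2norm v ^+ 2 = \sum_i normc (v i 0) ^+ 2.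
Proof. by rewrite sqr_sqrtr// sumr_ge0// => i _; exact: sqr_ge0. Qed.

Lemma l2norm_dot n (u v : 'cV[C]_n) :
  \sum_i normc (u i 0) * normc (v i 0) <= l2norm u * l2norm v.
Proof.
rewrite -(@ler_pXn2r _ 2)// ?nnegrE; last 2 first.
- by apply: sumr_ge0 => i _; rewrite mulr_ge0// normc_ge0.
- by rewrite mulr_ge0// l2norm_ge0.
by rewrite exprMn !l2norm_sqr cauchy_schwarz_sum.
Qed.

Lemma normc_le_l2norm n (v : 'cV[C]_n) i : normc (v i 0) <= l2norm v.
Proof.
rewrite -(@ler_pXn2r _ 2)// ?nnegrE ?normc_ge0 ?l2norm_ge0//.
rewrite l2norm_sqr (bigD1 i)//= lerDl sumr_ge0// => j _; exact: sqr_ge0.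
Qed.

Lemma l2normD n (u v : 'cV[C]_n) : l2norm (u + v) <= l2norm u + l2norm v.
Proof.
rewrite -(@ler_pXn2r _ 2)// ?nnegrE ?l2norm_ge0 ?addr_ge0 ?l2norm_ge0//.
rewrite sqrrD !l2norm_sqr.
apply: (@le_trans _ _ (\sum_i (normc (u i 0) + normc (v i 0)) ^+ 2)).
  apply: ler_sum => i _; rewrite ler_pXn2r ?nnegrE ?addr_ge0 ?normc_ge0//.
  by rewrite mxE le_normcD.
under eq_bigr do rewrite sqrrD.
rewrite !big_split /= lerD2r lerD2l.
by rewrite mulr2n lerD// l2norm_dot.
Qed.

Lemma l2normZ n (c : C) (v : 'cV[C]_n) :
  l2norm (c *: v) = normc c * l2norm v.
Proof.
rewrite /l2norm; under eq_bigr do rewrite mxE normcM exprMn.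
rewrite -mulr_sumr sqrtrM ?sqr_ge0// sqrtr_sqr ger0_norm//.
exact: normc_ge0.
Qed.

Lemma l2norm0 n : l2norm (0 : 'cV[C]_n) = 0.
Proof. by rewrite -(scale0r 0) l2normZ normc0 mul0r. Qed.

Lemma l2norm_eq0 n (v : 'cV[C]_n) : l2norm v = 0 -> v = 0.
Proof.
move=> v0; apply/matrixP => i j; rewrite ord1 mxE; apply: eq0_normc.
by apply/eqP; rewrite eq_le normc_ge0 -v0 normc_le_l2norm.
Qed.

Lemma l2norm_le n (v : 'cV[C]_n) (c : R) : 0 <= c ->
  (forall i, normc (v i 0) <= c) -> l2norm v <= n%:R * c.
Proof.
move=> c0 vc; rewrite -(@ler_pXn2r _ 2)// ?nnegrE ?l2norm_ge0 ?mulr_ge0//.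
rewrite l2norm_sqr; apply: (@le_trans _ _ (\sum_(i < n) c ^+ 2)).
  by apply: ler_sum => i _; rewrite ler_pXn2r ?nnegrE ?normc_ge0.
rewrite sumr_const card_ord -[leLHS]mulr_natl exprMn ler_wpM2r ?sqr_ge0//.
by rewrite -natrX ler_nat; case: (n) => // m; rewrite expnS expn1 leq_pmulr.
Qed.

Lemma normc_sum (I : Type) (s : seq I) (f : I -> C) :
  normc (\sum_(i <- s) f i) <= \sum_(i <- s) normc (f i).
Proof.
elim/big_rec2 : _ => [|i y x _ xy]; first by rewrite normc0.
by apply: le_trans (le_normcD _ _) _; rewrite lerD2l.
Qed.

Lemma l2norm_mulmx_le n (M : 'M[C]_n) (K : R) (v : 'cV[C]_n) : 0 <= K ->
  (forall i j, normc (M i j) <= K) ->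
  l2norm (M *m v) <= n%:R * (n%:R * K) * l2norm v.
Proof.
move=> K0 MK; rewrite -!mulrA; apply: l2norm_le => [|i].
  by rewrite !mulr_ge0// l2norm_ge0.
rewrite mxE; apply: le_trans (normc_sum _ _) _.
apply: (@le_trans _ _ (\sum_(j < n) K * l2norm v)).
  apply: ler_sum => j _; rewrite normcM ler_pM ?normc_ge0//.
  exact: normc_le_l2norm.
by rewrite sumr_const card_ord mulr_natl.
Qed.

Lemma opnorm_le n (M : 'M[C]_n) (c : R) :
  (forall v, l2norm v <= 1 -> l2norm (M *m v) <= c) -> opnorm M <= c.
Proof.
move=> Mc; apply: ge_sup => [|_ [v v1 <-]]; last exact: Mc.
by exists (l2norm (M *m 0)), 0 => //=; rewrite l2norm0 ler01.
Qed.

Lemma l2norm_mulmx_opnorm1 n (M : 'M[C]_n) (v : 'cV[C]_n) :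
  l2norm v <= 1 -> l2norm (M *m v) <= opnorm M.
Proof.
move=> v1; apply: ub_le_sup; last by exists v.
pose K := \sum_i \sum_j normc (M i j).
have K0 : 0 <= K.
  by do 2! (apply: sumr_ge0 => ? _); exact: normc_ge0.
have MK i j : normc (M i j) <= K.
  rewrite /K (bigD1 i)//= (bigD1 j)//= -addrA lerDl addr_ge0//.
    by apply: sumr_ge0 => ? _; exact: normc_ge0.
  by do 2! (apply: sumr_ge0 => ? _); exact: normc_ge0.
exists (n%:R * (n%:R * K)) => _ [w w1 <-].
apply: le_trans (l2norm_mulmx_le _ K0 MK) _.
by rewrite ler_piMr// !mulr_ge0.
Qed.

Lemma opnorm_ge0 n (M : 'M[C]_n) : 0 <= opnorm M.
Proof.
apply: le_trans (l2norm_mulmx_opnorm1 M (_ : l2norm 0 <= 1)).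
  exact: l2norm_ge0.
by rewrite l2norm0.
Qed.

Lemma l2norm_mulmx_opnorm n (M : 'M[C]_n) (v : 'cV[C]_n) :
  l2norm (M *m v) <= opnorm M * l2norm v.
Proof.
have [/l2norm_eq0->|v0] := eqVneq (l2norm v) 0.
  by rewrite mulmx0 l2norm0 mulr0.
have vp : 0 < l2norm v by rewrite lt_def v0 l2norm_ge0.
have normcl : normc (l2norm v)^-1%:C = (l2norm v)^-1.
  by rewrite /= expr0n addr0 sqrtr_sqr ger0_norm// invr_ge0 ltW.
have := @l2norm_mulmx_opnorm1 _ M ((l2norm v)^-1%:C *: v).
rewrite l2normZ normcl mulVf// lexx => /(_ isT).
by rewrite -scalemxAr l2normZ normcl mulrC ler_pdivrMr.
Qed.

Lemma opnorm_le_entry n (M : 'M[C]_n) (K : R) : 0 <= K ->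
  (forall i j, normc (M i j) <= K) -> opnorm M <= n%:R * (n%:R * K).
Proof.
move=> K0 MK; apply: opnorm_le => v v1.
apply: le_trans (l2norm_mulmx_le _ K0 MK) _.
by rewrite ler_piMr// !mulr_ge0.
Qed.

Lemma normc_le_opnorm n (M : 'M[C]_n) i j : normc (M i j) <= opnorm M.
Proof.
have d1 : l2norm (delta_mx j 0 : 'cV[C]_n) <= 1.
  rewrite /l2norm (bigD1 j)//= big1 => [|k kj]; rewrite !mxE.
    by rewrite !eqxx normc1 expr1n addr0 sqrtr1.
  by rewrite (negPf kj) normc0 expr0n.
apply: le_trans (l2norm_mulmx_opnorm1 M d1).
by apply: le_trans (normc_le_l2norm _ i); rewrite -colE mxE.
Qed.

Lemma opnormD n (M N : 'M[C]_n) : opnorm (M + N) <= opnorm M + opnorm N.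
Proof.
apply: opnorm_le => v v1; rewrite mulmxDl; apply: le_trans (l2normD _ _) _.
by rewrite lerD// l2norm_mulmx_opnorm1.
Qed.

Let opnormZ_le n (c : C) (M : 'M[C]_n) :
  opnorm (c *: M) <= normc c * opnorm M.
Proof.
apply: opnorm_le => v v1; rewrite -scalemxAl l2normZ.
by rewrite ler_wpM2l ?normc_ge0// l2norm_mulmx_opnorm1.
Qed.

Lemma opnormZ n (c : C) (M : 'M[C]_n) : opnorm (c *: M) = normc c * opnorm M.
Proof.
apply/eqP; rewrite eq_le opnormZ_le/=.
have [->|c0] := eqVneq c 0; first by rewrite normc0 mul0r opnorm_ge0.
have cp : 0 < normc c.
  rewrite lt_def normc_ge0 andbT; apply: contra c0 => /eqP/eq0_normc ->//.
rewrite -ler_pdivlMl// -normcV -{1}[M](scalerK c0).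
exact: opnormZ_le.
Qed.

Lemma opnormM n (M N : 'M[C]_n) : opnorm (M *m N) <= opnorm M * opnorm N.
Proof.
apply: opnorm_le => v v1; rewrite -mulmxA.
apply: le_trans (l2norm_mulmx_opnorm _ _) _.
by rewrite ler_wpM2l ?opnorm_ge0// l2norm_mulmx_opnorm1.
Qed.

Lemma adjmxK n : involutive (@adjmx n).
Proof. by move=> M; apply/matrixP => i j; rewrite !mxE conjcK. Qed.

Lemma adjmxM n (M N : 'M[C]_n) : adjmx (M *m N) = adjmx N *m adjmx M.
Proof. by rewrite /adjmx trmx_mul map_mxM. Qed.

Let opnorm_star_ge n (M : 'M[C]_n) : opnorm M ^+ 2 <= opnorm (adjmx M *m M).
Proof.
rewrite -[leRHS]sqr_sqrtr ?opnorm_ge0// ler_pXn2r ?nnegrE ?opnorm_ge0//;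
  last exact: sqrtr_ge0.
apply: opnorm_le => v v1.
rewrite -(@ler_pXn2r _ 2)// ?nnegrE ?l2norm_ge0 ?sqrtr_ge0//.
rewrite [leRHS]sqr_sqrtr ?opnorm_ge0//.
suff -> : l2norm (M *m v) ^+ 2 =
    normc (\sum_j (v j 0)^* * (adjmx M *m M *m v) j 0).
  apply: le_trans (normc_sum _ _) _.
  under eq_bigr => j _.
    rewrite normcM (_ : normc (v j 0)^* = normc (v j 0)); last first.
      by case: (v j 0) => x y /=; rewrite sqrrN.
    over.
  apply: le_trans (l2norm_dot _ _) _.
  apply: le_trans (_ : 1 * l2norm (adjmx M *m M *m v) <= _).
    by rewrite ler_wpM2r ?l2norm_ge0.
  by rewrite mul1r l2norm_mulmx_opnorm1.
have -> : \sum_j (v j 0)^* * (adjmx M *m M *m v) j 0 = (l2norm (M *m v) ^+ 2)%:C.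
  rewrite l2norm_sqr rmorph_sum /=.
  transitivity ((map_mx conjc (v^T) *m (adjmx M *m M *m v)) 0 0).
    by rewrite [RHS]mxE; apply: eq_bigr => j _; rewrite !mxE.
  rewrite -mulmxA mulmxA -map_mxM -trmx_mul mxE; apply: eq_bigr => j _.
  rewrite rmorphXn /= -normcR sqr_normc !mxE mulrC; congr (_ * _).
by rewrite /= expr0n addr0 sqrtr_sqr ger0_norm// sqr_ge0.
Qed.

Let opnorm_adj_ge n (M : 'M[C]_n) : opnorm M <= opnorm (adjmx M).
Proof.
have [->|M0] := eqVneq (opnorm M) 0; first exact: opnorm_ge0.
have Mp : 0 < opnorm M by rewrite lt_def M0 opnorm_ge0.
rewrite -(ler_pM2r Mp) -expr2.
exact: le_trans (opnorm_star_ge _) (opnormM _ _).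
Qed.

Lemma opnorm_adj n (M : 'M[C]_n) : opnorm (adjmx M) = opnorm M.
Proof.
by apply/eqP; rewrite eq_le opnorm_adj_ge -{2}[M]adjmxK opnorm_adj_ge.
Qed.

Lemma opnorm_star n (M : 'M[C]_n) : opnorm (adjmx M *m M) = opnorm M ^+ 2.
Proof.
apply/eqP; rewrite eq_le opnorm_star_ge andbT.
by apply: le_trans (opnormM _ _) _; rewrite opnorm_adj expr2.
Qed.

End EuclideanNorm.

Definition cfun (R : realType) (a b : R) : Type :=
  continuousType (set_type `[a, b]%classic) R[i].

Section ContinuousFunctions.
Variables (R : realType) (a b : R).
Local Notation T := (set_type `[a, b]%classic).
Local Notation F := (cfun a b).

HB.instance Definition _ := Choice.on F.

Definition cfun_fun (f : F) : T -> R[i] := f.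

Lemma cfun_cts (f : F) : continuous (cfun_fun f).
Proof. exact: (@cts_fun _ _ f). Qed.

Lemma cfun_near (f : F) (t : T) (e : R[i]) : 0 < e ->
  \forall s \near t, `|cfun_fun f t - cfun_fun f s| <= e.
Proof.
have /(@cvgrPdist_le _ _ T (nbhs t) (nbhs_filter t)) := @cfun_cts f t.
exact.
Qed.

Lemma cfunP (f g : F) : cfun_fun f =1 cfun_fun g -> f = g.
Proof. by move=> fg; apply/continuousEP. Qed.

Definition mk_cfun (f : T -> R[i]) (fc : continuous f) : F := mkcts fc.

Lemma cfunD_cts (f g : F) :
  continuous (fun t => cfun_fun f t + cfun_fun g t).
Proof. by move=> t; exact: (cvgD (@cfun_cts f t) (@cfun_cts g t)). Qed.
Lemma cfunN_cts (f : F) : continuous (fun t => - cfun_fun f t).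
Proof. by move=> t; exact: (cvgN (@cfun_cts f t)). Qed.
Lemma cfunM_cts (f g : F) :
  continuous (fun t => cfun_fun f t * cfun_fun g t).
Proof. by move=> t; exact: (cvgZ (@cfun_cts f t) (@cfun_cts g t)). Qed.
Lemma cfunZ_cts (c : R[i]) (f : F) : continuous (fun t => c * cfun_fun f t).
Proof.
by move=> t; exact: (cvgZ (@cvg_cst R[i] c T (nbhs t) (nbhs_filter t)) (@cfun_cts f t)).
Qed.
Lemma cfun_conj_cts (f : F) : continuous (fun t => (cfun_fun f t)^*).
Proof.
move=> t; apply/(@cvgrPdist_le _ _ T (nbhs t) (nbhs_filter t)) => e e0.
have H := @cfun_near f t _ e0.
by apply: filterS H => s; rewrite -(rmorphB conjc) normcJ.
Qed.
Lemma cfun_cst_cts (c : R[i]) : continuous (fun _ : T => c).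
Proof.
by move=> t; exact: (@cvg_cst R[i] c T (nbhs t) (nbhs_filter t)). Qed.

Let fadd (f g : F) : F := mk_cfun (@cfunD_cts f g).
Let fopp (f : F) : F := mk_cfun (@cfunN_cts f).
Let fmul (f g : F) : F := mk_cfun (@cfunM_cts f g).
Let fcst (c : R[i]) : F := mk_cfun (@cfun_cst_cts c).
Let fscale (c : R[i]) (f : F) : F := mk_cfun (@cfunZ_cts c f).
Definition cfun_conj (f : F) : F := mk_cfun (@cfun_conj_cts f).

Let faddA : associative fadd.
Proof. by move=> f g h; apply: cfunP => t; exact: addrA. Qed.
Let faddC : commutative fadd.
Proof. by move=> f g; apply: cfunP => t; exact: addrC. Qed.
Let fadd0 : left_id (fcst 0) fadd.
Proof. by move=> f; apply: cfunP => t; exact: add0r. Qed.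
Let faddN : left_inverse (fcst 0) fopp fadd.
Proof. by move=> f; apply: cfunP => t; exact: addNr. Qed.

HB.instance Definition _ := GRing.isZmodule.Build F faddA faddC fadd0 faddN.

Let fmulA : associative fmul.
Proof. by move=> f g h; apply: cfunP => t; exact: mulrA. Qed.
Let fmulC : commutative fmul.
Proof. by move=> f g; apply: cfunP => t; exact: mulrC. Qed.
Let fmul1 : left_id (fcst 1) fmul.
Proof. by move=> f; apply: cfunP => t; exact: mul1r. Qed.
Let fmulD : left_distributive fmul +%R.
Proof. by move=> f g h; apply: cfunP => t; exact: mulrDl. Qed.

HB.instance Definition _ :=
  GRing.Zmodule_isComPzRing.Build F fmulA fmulC fmul1 fmulD.

Let fscaleA c d f : fscale c (fscale d f) = fscale (c * d) f.
Proof. by apply: cfunP => t; exact: mulrA. Qed.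
Let fscale1 : left_id 1 fscale.
Proof. by move=> f; apply: cfunP => t; exact: mul1r. Qed.
Let fscaleDr : right_distributive fscale +%R.
Proof. by move=> c f g; apply: cfunP => t; exact: mulrDr. Qed.
Let fscaleDl f : {morph fscale^~ f : c d / c + d}.
Proof. by move=> c d; apply: cfunP => t; exact: mulrDl. Qed.

HB.instance Definition _ := GRing.Zmodule_isLmodule.Build R[i] F
  fscaleA fscale1 fscaleDr fscaleDl.

Lemma cfunDE (f g : F) t : cfun_fun (f + g) t = cfun_fun f t + cfun_fun g t.
Proof. by []. Qed.

Lemma cfunME (f g : F) t : cfun_fun (f * g) t = cfun_fun f t * cfun_fun g t.
Proof. by []. Qed.

Lemma cfunZE (c : R[i]) (f : F) t : cfun_fun (c *: f) t = c * cfun_fun f t.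
Proof. by []. Qed.

Lemma cfun_sumE (I : Type) (s : seq I) (f : I -> F) t :
  cfun_fun (\sum_(i <- s) f i) t = \sum_(i <- s) cfun_fun (f i) t.
Proof. by apply: (big_morph (fun f => cfun_fun f t)). Qed.

Lemma cfun_bounded (f : F) : exists2 K : R, 0 <= K &
  forall t, normc (cfun_fun f t) <= K.
Proof.
pose g : T -> R := fun t => normc (cfun_fun f t).
have gc : continuous g.
  move=> t; apply/(@cvgrPdist_le _ _ T (nbhs t) (nbhs_filter t)) => e e0.
  have eC : 0 < e%:C :> R[i] by rewrite ltr_real_complex.
  have H := @cfun_near f t _ eC.
  apply: filterS H => s; rewrite -ler_real_complex => /(le_trans _); apply.
  apply: le_trans (ler_dist_dist (cfun_fun f t) (cfun_fun f s)).
  rewrite !normcR -rmorphB ler_real_complex.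
  by rewrite /= expr0n addr0 sqrtr_sqr.
have /subspace_valL_continuousP gw := gc.
have := continuous_compact gw (@segment_compact _ a b).
move=> /compact_bounded[M [Mr MK]]; exists (`|M| + 1) => [|t];
  first by rewrite addr_ge0.
have := MK (`|M| + 1); rewrite ltr_pwDr ?ler_norm//= => /(_ isT) {}MK.
apply: le_trans (ler_norm _) (MK _ _); exists (val t).
  by case: (t) => x /= /set_mem.
exact: (congr1 (fun h => h t) (valLK point g)).
Qed.

End ContinuousFunctions.

(* An alias, so that it can carry the C*-norm instead of the entrywise topology
   that the library puts on matrices. *)
Definition cmx (R : realType) (a b : R) (n : nat) : Type := 'M[cfun a b]_n.

Section MatrixAlgebra.
Variables (R : realType) (a b : R) (n : nat).
Local Notation T := (set_type `[a, b]%classic).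
Local Notation M := (cmx a b n).
Implicit Types A B : M.

Definition cmx_eval (A : M) (t : T) : 'M[R[i]]_n :=
  map_mx (fun f => cfun_fun f t) A.

(* M_n(C[a,b]) = C([a,b], M_n(C)): supremum over t of the operator norms on
   Hilbert space C^n. *)
Definition cmx_norm (A : M) : R :=
  sup [set opnorm (cmx_eval A t) | t in [set: T]].

HB.instance Definition _ := GRing.Zmodule.copy M 'M[cfun a b]_n.

Let xscale (c : R[i]) (A : M) : M := map_mx (fun f => c *: f) A.
Let xmul (A B : M) : M := A *m B.
Let xstar (A : M) : M := map_mx (@cfun_conj R a b) A^T.

Let xscaleA c d A : xscale c (xscale d A) = xscale (c * d) A.
Proof. by apply/matrixP => i j; rewrite !mxE scalerA. Qed.
Let xscale1 : left_id 1 xscale.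
Proof. by move=> A; apply/matrixP => i j; rewrite !mxE scale1r. Qed.
Let xscaleDr : right_distributive xscale +%R.
Proof. by move=> c A B; apply/matrixP => i j; rewrite !mxE scalerDr. Qed.
Let xscaleDl A : {morph xscale^~ A : c d / c + d}.
Proof. by move=> c d; apply/matrixP => i j; rewrite !mxE scalerDl. Qed.

HB.instance Definition _ := GRing.Zmodule_isLmodule.Build R[i] M
  xscaleA xscale1 xscaleDr xscaleDl.

Lemma cmx_evalP A B : (forall t, cmx_eval A t = cmx_eval B t) -> A = B.
Proof.
move=> AB; apply/matrixP => i j; apply: cfunP => t.
by have /matrixP/(_ i j) := AB t; rewrite !mxE.
Qed.

Lemma cmx_evalD A B t : cmx_eval (A + B) t = cmx_eval A t + cmx_eval B t.
Proof. by apply/matrixP => i j; rewrite !mxE. Qed.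

Lemma cmx_evalZ (c : R[i]) A t : cmx_eval (c *: A) t = c *: cmx_eval A t.
Proof. by apply/matrixP => i j; rewrite !mxE. Qed.

Lemma cmx_evalM A B t : cmx_eval (xmul A B) t = cmx_eval A t *m cmx_eval B t.
Proof.
apply/matrixP => i j; rewrite !mxE cfun_sumE; apply: eq_bigr => k _.
by rewrite !mxE cfunME.
Qed.

Lemma cmx_eval_star A t : cmx_eval (xstar A) t = adjmx (cmx_eval A t).
Proof. by apply/matrixP => i j; rewrite !mxE. Qed.

Lemma opnorm_cmx_le A t : opnorm (cmx_eval A t) <= cmx_norm A.
Proof.
apply: ub_le_sup; last by exists t.
pose K i j := s2val (cid2 (cfun_bounded (A i j))).
have K0 i j : 0 <= K i j by rewrite /K; case: cid2.
have KP i j s : normc (cmx_eval A s i j) <= K i j.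
  by rewrite mxE /K; case: cid2.
pose L := \sum_i \sum_j K i j.
exists (n%:R * (n%:R * L)) => _ [s _ <-]; apply: opnorm_le_entry => [|i j].
  by do 2! (apply: sumr_ge0 => ? _).
apply: le_trans (KP i j s) _.
rewrite /L (bigD1 i)//= (bigD1 j)//= -addrA lerDl addr_ge0//.
  by apply: sumr_ge0.
by do 2! (apply: sumr_ge0 => ? _).
Qed.

Lemma cmx_norm_le A (c : R) : 0 <= c ->
  (forall t, opnorm (cmx_eval A t) <= c) -> cmx_norm A <= c.
Proof.
move=> c0 Ac; rewrite /cmx_norm; set S := [set _ | _ in _].
have [->|S0] := eqVneq S set0; first by rewrite sup0.
by apply: ge_sup => [|_ [t _ <-]]; [exact/set0P | exact: Ac].
Qed.

Lemma cmx_norm_ge0 A : 0 <= cmx_norm A.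
Proof.
rewrite /cmx_norm; set S := [set _ | _ in _].
have [->|/set0P[_ [t _ _]]] := eqVneq S set0; first by rewrite sup0.
exact: le_trans (opnorm_ge0 _) (opnorm_cmx_le A t).
Qed.

Let xnorm (A : M) : R[i] := (cmx_norm A)%:C.

Let xnormD A B : xnorm (A + B) <= xnorm A + xnorm B.
Proof.
rewrite /xnorm -rmorphD /= ler_real_complex.
apply: cmx_norm_le => [|t]; first by rewrite addr_ge0 ?cmx_norm_ge0.
rewrite cmx_evalD; apply: le_trans (opnormD _ _) _.
by rewrite lerD ?opnorm_cmx_le.
Qed.

Let cmx_normZ_le (c : R[i]) A : cmx_norm (c *: A) <= normc c * cmx_norm A.
Proof.
apply: cmx_norm_le => [|t]; first by rewrite mulr_ge0 ?cmx_norm_ge0 ?normc_ge0.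
by rewrite cmx_evalZ opnormZ ler_wpM2l ?normc_ge0 ?opnorm_cmx_le.
Qed.

Let xnormZ (c : R[i]) A : xnorm (c *: A) = `|c| * xnorm A.
Proof.
rewrite normcR /xnorm -rmorphM; congr (_%:C); apply/eqP.
rewrite eq_le cmx_normZ_le/=.
have [->|c0] := eqVneq c 0; first by rewrite normc0 mul0r cmx_norm_ge0.
have cp : 0 < normc c.
  rewrite lt_def normc_ge0 andbT; apply: contra c0 => /eqP/eq0_normc ->//.
rewrite -ler_pdivlMl// -normcV -{1}[A](scalerK c0).
exact: cmx_normZ_le.
Qed.

Let xnorm0 A : xnorm A = 0 -> A = 0.
Proof.
move=> /complexI A0; apply/matrixP => i j; apply: cfunP => t; rewrite mxE.
apply: eq0_normc; apply/eqP; rewrite eq_le normc_ge0 andbT -A0.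
apply: le_trans (opnorm_cmx_le A t).
by have := normc_le_opnorm (cmx_eval A t) i j; rewrite mxE.
Qed.

HB.instance Definition _ := @Lmodule_isNormed.Build R[i] M
  xnorm xnormD xnormZ xnorm0.

Lemma cmx_normE A : `|A| = (cmx_norm A)%:C.
Proof. by []. Qed.

Lemma normc_le_cmx_norm A i j t : normc (cfun_fun (A i j) t) <= cmx_norm A.
Proof.
apply: le_trans (opnorm_cmx_le A t).
by have := normc_le_opnorm (cmx_eval A t) i j; rewrite mxE.
Qed.

Let xcomplete (F : set_system M) : ProperFilter F -> cauchy F -> cvg F.
Proof.
move=> FF /cauchyP Fc.
have Fcn (e : R) : 0 < e -> exists A, F [set B | cmx_norm (A - B) < e].
  move=> e0; have eC : 0 < e%:C :> R[i] by rewrite ltr_real_complex.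
  have [A FA] := Fc _ eC; exists A; apply: filterS FA => B.
  by rewrite -ball_normE /ball_ /= cmx_normE ltr_real_complex.
pose p i j t : M -> R[i] := fun A => cfun_fun (A i j) t.
have pB i j t A B : p i j t (A - B) = p i j t A - p i j t B.
  by rewrite /p !mxE.
have pl i j t : cvg (p i j t @ F).
  apply: cauchy_cvg; apply/cauchyP => e e0.
  have [A FA] := Fc _ e0; exists (p i j t A).
  change (F (p i j t @^-1` ball (p i j t A) e)).
  apply: filterS FA => B; rewrite /= -!ball_normE /ball_ /= => AB.
  apply: le_lt_trans AB; rewrite -pB normcR cmx_normE ler_real_complex.
  exact: normc_le_cmx_norm.
pose l i j t : R[i] := lim (p i j t @ F).
have lP (e : R) : 0 < e ->
    F [set A | forall i j t, normc (l i j t - p i j t A) <= e].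
  move=> e0; have e20 : 0 < e / 2 by rewrite divr_gt0.
  have [A0 FA0] := Fcn _ e20.
  have lA0 i j t : normc (l i j t - p i j t A0) <= e / 2.
    apply/ler_addgt0Pr => d d0.
    have dC : 0 < d%:C :> R[i] by rewrite ltr_real_complex.
    have Fl : F [set A | `|l i j t - p i j t A| <= d%:C].
      by have /cvgrPdist_le/(_ _ dC) := pl i j t.
    have [B [/= B1 B2]] := filter_ex (filterI FA0 Fl).
    rewrite (_ : _ - _ = (l i j t - p i j t B) - p i j t (A0 - B)); last first.
      by rewrite pB; ring.
    apply: le_trans (le_normcD _ _) _; rewrite normcN addrC lerD//.
      exact: le_trans (normc_le_cmx_norm _ _ _ _) (ltW B1).
    by rewrite -ler_real_complex -normcR.
  apply: filterS FA0 => B /= B1 i j t.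
  rewrite (_ : _ - _ = (l i j t - p i j t A0) + p i j t (A0 - B)); last first.
    by rewrite pB; ring.
  apply: le_trans (le_normcD _ _) _; rewrite [e]splitr lerD//.
  exact: le_trans (normc_le_cmx_norm _ _ _ _) (ltW B1).
have lc i j : continuous (l i j).
  move=> t; apply/(@cvgrPdist_le _ _ T (nbhs t) (nbhs_filter t)) => e e0.
  have eR : e = (Re e)%:C by rewrite RRe_real// gtr0_real.
  have e30 : 0 < Re e / 3 by rewrite divr_gt0// -ltr_real_complex -eR.
  have e3C : 0 < (Re e / 3)%:C :> R[i] by rewrite ltr_real_complex.
  have [A /= Al] := filter_ex (lP _ e30).
  have H := cfun_near (A i j) t e3C.
  apply: filterS H => s; rewrite normcR ler_real_complex => H.
  rewrite eR normcR ler_real_complex.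
  rewrite (_ : _ - _ = (l i j t - p i j t A) + (p i j t A - p i j s A)
    - (l i j s - p i j s A)); last by ring.
  apply: le_trans (le_normcD _ _) _; rewrite normcN.
  apply: le_trans (lerD (le_normcD _ _) (Al i j s)) _.
  apply: le_trans (lerD (lerD (Al i j t) H) (lexx _)) _.
  by lra.
pose L : M := \matrix_(i, j) mk_cfun (lc i j).
apply/cvg_ex; exists L; apply/cvgrPdist_le => e e0.
have eR : e = (Re e)%:C by rewrite RRe_real// gtr0_real.
have n0 : 0 < (n * n).+1%:R :> R by rewrite ltr0n.
have en0 : 0 < Re e / (n * n).+1%:R.
  by rewrite divr_gt0// -ltr_real_complex -eR.
apply: filterS (lP _ en0) => A /= Al.
rewrite eR cmx_normE ler_real_complex; apply: cmx_norm_le => [|t].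
  by rewrite ltW// -ltr_real_complex -eR.
apply: le_trans (opnorm_le_entry (ltW en0) _) _ => [i j|].
  by rewrite !mxE; exact: Al.
rewrite !mulrA -natrM ler_pdivrMr// mulrC ler_wpM2l//.
  by rewrite ltW// -ltr_real_complex -eR.
by rewrite ler_nat.
Qed.

HB.instance Definition _ := Uniform_isComplete.Build M xcomplete.

Let xmulA : associative xmul. Proof. exact: mulmxA. Qed.
Let xmulDl : left_distributive xmul +%R.
Proof. by move=> A B D; exact: mulmxDl. Qed.
Let xmulDr : right_distributive xmul +%R.
Proof. by move=> A B D; exact: mulmxDr. Qed.
Let xmulZl (c : R[i]) A B : xmul (c *: A) B = c *: xmul A B.
Proof.
by apply: cmx_evalP => t; rewrite cmx_evalM !cmx_evalZ cmx_evalM scalemxAl.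
Qed.
Let xmulZr (c : R[i]) A B : xmul A (c *: B) = c *: xmul A B.
Proof.
by apply: cmx_evalP => t; rewrite cmx_evalM !cmx_evalZ cmx_evalM scalemxAr.
Qed.
Let xstarK : involutive xstar.
Proof.
by move=> A; apply: cmx_evalP => t; rewrite !cmx_eval_star adjmxK.
Qed.
Let xstarD : {morph xstar : A B / A + B}.
Proof.
move=> A B; apply: cmx_evalP => t.
rewrite cmx_evalD !cmx_eval_star cmx_evalD.
by apply/matrixP => i j; rewrite !mxE rmorphD.
Qed.
Let xstarZ (c : R[i]) A : xstar (c *: A) = c^* *: xstar A.
Proof.
apply: cmx_evalP => t; rewrite cmx_evalZ !cmx_eval_star cmx_evalZ.
by apply/matrixP => i j; rewrite !mxE rmorphM.
Qed.
Let xstarM A B : xstar (xmul A B) = xmul (xstar B) (xstar A).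
Proof.
by apply: cmx_evalP => t; rewrite cmx_evalM !cmx_eval_star cmx_evalM adjmxM.
Qed.
Let xnormM A B : `|xmul A B| <= `|A| * `|B|.
Proof.
rewrite !cmx_normE -rmorphM /= ler_real_complex.
apply: cmx_norm_le => [|t]; first by rewrite mulr_ge0 ?cmx_norm_ge0.
rewrite cmx_evalM; apply: le_trans (opnormM _ _) _.
by rewrite ler_pM ?opnorm_ge0 ?opnorm_cmx_le.
Qed.
Let xnorm_star A : `|xmul (xstar A) A| = `|A| ^+ 2.
Proof.
have evE t : opnorm (cmx_eval (xmul (xstar A) A) t) = opnorm (cmx_eval A t) ^+ 2.
  by rewrite cmx_evalM cmx_eval_star opnorm_star.
rewrite !cmx_normE -rmorphXn; congr (_%:C); apply/eqP; rewrite eq_le.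
apply/andP; split.
  apply: cmx_norm_le => [|t]; first exact: sqr_ge0.
  rewrite evE ler_pXn2r ?nnegrE ?opnorm_ge0 ?cmx_norm_ge0//.
  exact: opnorm_cmx_le.
rewrite -[leRHS]sqr_sqrtr ?cmx_norm_ge0// ler_pXn2r ?nnegrE ?cmx_norm_ge0//;
  last exact: sqrtr_ge0.
apply: cmx_norm_le => [|t]; first exact: sqrtr_ge0.
rewrite -[leLHS]ger0_norm ?opnorm_ge0// -sqrtr_sqr -evE ler_wsqrtr//.
exact: opnorm_cmx_le.
Qed.

HB.instance Definition _ := isCstarAlgebra.Build R M
  xmulA xmulDl xmulDr xmulZl xmulZr xstarK xstarD xstarZ xstarM
  xnormM xnorm_star.

End MatrixAlgebra.

Section TheIdempotent.
Variables (R : realType) (r : R).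

Definition d_of : R := 1 / 2 * (r + 1).
Local Notation T := (set_type `[1, d_of]%classic).

Lemma real_complex_continuous (g : R -> R) :
  continuous g -> continuous (fun t : T => (g (val t))%:C).
Proof.
move=> gc t; apply/(@cvgrPdist_le _ _ T (nbhs t) (nbhs_filter t)) => e e0.
have eR : e = (Re e)%:C by rewrite RRe_real// gtr0_real.
have e1 : 0 < Re e by rewrite -ltr_real_complex -eR.
have /cvgrPdist_le/(_ _ e1) H := gc (val t).
have := @initial_continuous _ _ set_val t _ H.
apply: (@filterS _ (nbhs t) (nbhs_filter t)) => s /= st.
rewrite -rmorphB normcR eR ler_real_complex /=.
by rewrite expr0n addr0 sqrtr_sqr.
Qed.

Lemma ell_continuous : continuous (fun t : R => Num.sqrt (t * (t - 1))).
Proof.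
move=> t; apply: (@continuous_comp _ _ _ (fun t : R => t * (t - 1)) Num.sqrt);
  last exact: sqrt_continuous.
by apply: cvgM; [exact: cvg_id | apply: cvgB; [exact: cvg_id | exact: cvg_cst]].
Qed.

Definition I0 : cfun 1 d_of :=
  mk_cfun (real_complex_continuous (g := fun _ => 1)
    (fun t => @cvg_cst R 1 R (nbhs t) _)).

Definition D0 : cfun 1 d_of :=
  mk_cfun (real_complex_continuous (g := fun t => t)
    (fun t => @cvg_id R (nbhs t))).

Definition ellD0 : cfun 1 d_of :=
  mk_cfun (real_complex_continuous (g := fun t => Num.sqrt (t * (t - 1)))
    ell_continuous).

Definition Q_matrix : cmx 1 d_of 2 :=
  \matrix_(i < 2, j < 2)
    if i == 0 then (if j == 0 then D0 else - ellD0)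
    else (if j == 0 then ellD0 else I0 - D0).

Definition Q_ : (R[i] * zero_algebra R * cmx 1 d_of 2)%type :=
  (1, 0, Q_matrix).

End TheIdempotent.

(* Main.v *)
(** Write w = i(E - E* ) and Z = E + E* - 1 for an idempotent E.  Then w and Z
    are self-adjoint, Zw = -wZ, Z^2 = 1 + w^2 and E = (1 + Z - iw) / 2, so the
    elements p(w) + Z q(w), with polynomials p and q, form a *-algebra containing
    E.  In the matrix Q_r(t) the element w has the eigenvalues 2 l(t) and -2 l(t),
    and these fill the interval [-rho, rho] with rho^2 = r^2 - 1; diagonalizing w
    shows that |p| and sqrt(1 + x^2) |q| are bounded there by a multiple of the
    norm of p(w) + Z q(w).  In an arbitrary C*-algebra, the identity
    (1 + w^2) E = E E* E and a power trick give ||w|| <= rho, so that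
    ||p(w)|| <= sup |p| on that interval.  Hence p(w) + Z q(w) has, for any
    idempotent of norm at most r, norm at most a constant times its norm for Q_r,
    and the C*-algebra generated by (Q_r, Q') in the direct sum is the graph of a
    *-homomorphism.

    The bound by the supremum needs no spectral theory: it holds for every
    seminorm nu on R[X] that satisfies nu(p)^2 <= nu(p^2 + q^2).  Call p positive
    if nu(L - p) <= L for some L; this means being approximately a square, so
    products of positive polynomials are positive, and a polynomial that is
    positive on the interval is a product of manifestly positive ones. *)

Require Import Defs.
From HB Require Import structures.
From mathcomp Require Import all_boot all_order all_algebra.
From mathcomp Require Import complex.
From mathcomp Require Import mathcomp_extra boolp classical_sets functions.
From mathcomp Require Import reals.
From mathcomp Require Import topology normedtype realfun.
From mathcomp Require Import ring lra ssrAC.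

Set Implicit Arguments.
Unset Strict Implicit.
Unset Printing Implicit Defensive.

Import Order.TTheory GRing.Theory Num.Theory.
Import Normc.
Import numFieldNormedType.Exports.

Local Notation Re := complex.Re.
Local Notation Im := complex.Im.

Local Open Scope classical_set_scope.
Local Open Scope complex_scope.
Local Open Scope ring_scope.
Local Open Scope cstar_scope.

(** * C*-seminorms on real polynomials *)

(** A factor linear in the exponent N cannot make up for exponential growth: if x = y (1 + h) with h
    > 0, then (1 + h)^N would be at most 1 + N C, where y >= 1 absorbs the leading 1. The exponents
    are powers of two because repeated squaring is how the C*-identity computes norms of powers. *)
Lemma le_of_pow_le_linear (R : realType) (x y C : R) : 1 <= y -> 0 <= C ->
  (forall k, x ^+ (2 ^ k) <= 1 + (2 ^ k)%:R * C * y ^+ (2 ^ k)) -> x <= y.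
Proof.
move=> y1 C0 xy; have y0 : 0 < y by apply: lt_le_trans y1.
rewrite leNgt; apply/negP => yx.
pose h := x / y - 1; have h0 : 0 < h by rewrite subr_gt0 ltr_pdivlMr// mul1r.
have xE : x = y * (1 + h) by rewrite /h; field; rewrite gt_eqF.
have bern n : 1 + n%:R * h <= (1 + h) ^+ n.
  elim: n => [|n IH]; first by rewrite mul0r addr0 expr0.
  rewrite exprS; apply: (@le_trans _ _ ((1 + h) * (1 + n%:R * h))).
    rewrite -natr1; have : 0 <= n%:R * h * h by rewrite !mulr_ge0// ltW.
    by nra.
  by rewrite ler_wpM2l// addr_ge0// ltW.
(* Squaring Bernoulli's inequality at exponent 2^k gives a quadratic lower bound at exponent
   2^(k+1), which beats the linear upper bound. *)
have key k : ((2 ^ k)%:R * h) ^+ 2 <= 1 + 2 * (2 ^ k)%:R * C.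
  have := xy k.+1; set N := (2 ^ k.+1)%N.
  have NE : N = (2 ^ k * 2)%N by rewrite /N expnSr.
  rewrite xE exprMn mulrC => H.
  have yN : 1 <= y ^+ N by rewrite exprn_ege1.
  have H1 : (1 + h) ^+ N <= 1 + N%:R * C.
    have yN0 : 0 < y ^+ N by apply: lt_le_trans yN.
    rewrite -(ler_pM2r yN0); apply: le_trans H _.
    by rewrite mulrDl mul1r lerD2r.
  have {H1} : (1 + h) ^+ N <= 1 + 2 * (2 ^ k)%:R * C.
    by apply: le_trans H1 _; rewrite NE natrM [_ * 2%:R]mulrC.
  apply: le_trans; rewrite NE exprM ler_pXn2r ?nnegrE//.
  - by apply: le_trans (bern _); rewrite lerDr.
  - by rewrite mulr_ge0// ltW.
  - by rewrite exprn_ge0// addr_ge0// ltW.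
pose B := (1 + 2 * C) / h ^+ 2.
have B0 : 0 <= B by rewrite divr_ge0// ?sqr_ge0// addr_ge0// mulr_ge0.
have [k kB] : exists k, B < (2 ^ k)%:R.
  exists (Num.bound B); apply: lt_trans (archi_boundP B0) _.
  by rewrite ltr_nat ltn_expl.
have := key k; set n := (2 ^ k)%:R : R in kB *.
have n1 : 1 <= n by rewrite /n ler1n expn_gt0.
move: kB; rewrite /B ltr_pdivrMr ?exprn_gt0// exprMn => kB.
apply/negP; rewrite -ltNge [ltRHS](_ : _ = n * (n * h ^+ 2)); last by ring.
apply: (@le_lt_trans _ _ (n * (1 + 2 * C))); last by rewrite ltr_pM2l//; lra.
by nra.
Qed.

Section CstarSeminorm.
Variable R : realType.

(** [csn_sqr] is what the C*-identity for a normal element p + iq says about its real part p; at q =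
    0 it yields nu(p^2) = nu(p)^2. [csnC] is an inequality because the unit may have seminorm 0, as
    over the zero algebra. *)
Record cstar_seminorm (nu : {poly R} -> R) : Prop := CstarSeminorm {
  csn_ge0 : forall p, 0 <= nu p;
  csnD : forall p q, nu (p + q) <= nu p + nu q;
  csnM : forall p q, nu (p * q) <= nu p * nu q;
  csnC : forall c, nu c%:P <= `|c|;
  csn_sqr : forall p q, nu p ^+ 2 <= nu (p ^+ 2 + q ^+ 2)
}.

Variable nu : {poly R} -> R.
Hypothesis nuP : cstar_seminorm nu.
Implicit Types p q b : {poly R}.

Let nu_ge0 := csn_ge0 nuP.
Let nuD := csnD nuP.
Let nuM := csnM nuP.
Let nuC := csnC nuP.
Let nu_sqr := csn_sqr nuP.

Lemma csnC_ge0 c : 0 <= c -> nu c%:P <= c.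
Proof. by move=> c0; apply: le_trans (nuC _) _; rewrite ger0_norm. Qed.

Lemma csn0 : nu 0 = 0.
Proof. by apply/eqP; rewrite eq_le nu_ge0 andbT -polyC0 csnC_ge0. Qed.

Lemma csnZ c p : nu (c *: p) <= `|c| * nu p.
Proof.
by rewrite -mul_polyC; apply: le_trans (nuM _ _) _; rewrite ler_wpM2r.
Qed.

Lemma csnN p : nu (- p) = nu p.
Proof.
have le q : nu (- q) <= nu q.
  by rewrite -scaleN1r; apply: le_trans (csnZ _ _) _; rewrite normrN1 mul1r.
by apply/eqP; rewrite eq_le le -{1}[p]opprK le.
Qed.

Lemma csnB p q : nu (p - q) <= nu p + nu q.
Proof. by apply: le_trans (nuD _ _) _; rewrite csnN. Qed.

Lemma csnX p n : nu (p ^+ n.+1) <= nu p ^+ n.+1.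
Proof.
elim: n => [|n IH]; first by rewrite !expr1.
rewrite exprS [leRHS]exprS; apply: le_trans (nuM _ _) _.
by rewrite ler_wpM2l.
Qed.

Lemma csn_expr2 p : nu (p ^+ 2) = nu p ^+ 2.
Proof.
apply/eqP; rewrite eq_le csnX/=.
by have := nu_sqr p 0; rewrite expr0n addr0.
Qed.

Lemma csn_expr_pow2 p k : nu (p ^+ (2 ^ k)) = nu p ^+ (2 ^ k).
Proof.
by elim: k => [|k IH]; rewrite ?expr1// expnSr !exprM csn_expr2 IH.
Qed.

(* The iteration y <- (b + y^2) / 2 converges to 1 - sqrt (1 - b); [eta] is its
   value at b = 1, which dominates the seminorms. *)
Lemma csn_sqrt1B b : nu b <= 1 -> forall e, 0 < e ->
  exists k, nu (1 - b - k ^+ 2) <= e.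
Proof.
move=> b1 e e0.
pose y n := iter n (fun z => 2^-1 *: (b + z ^+ 2)) 0 : {poly R}.
pose eta n := iter n (fun z => 2^-1 * (1 + z ^+ 2)) 0 : R.
have yS n : y n.+1 = 2^-1 *: (b + y n ^+ 2) by [].
have etaS n : eta n.+1 = 2^-1 * (1 + eta n ^+ 2) by [].
have half : `|2^-1 : R| = 2^-1 by rewrite ger0_norm// invr_ge0.
have eta01 n : 0 <= eta n <= 1.
  elim: n => [|n /andP[h0 h1]]; first by rewrite lexx ler01.
  by rewrite etaS; have h2 := sqr_ge0 (eta n); apply/andP; split; nra.
have yeta n : nu (y n) <= eta n.
  elim: n => [|n IH]; first by rewrite csn0.
  rewrite yS etaS; apply: le_trans (csnZ _ _) _.
  rewrite half ler_wpM2l ?invr_ge0//.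
  apply: le_trans (nuD _ _) _; rewrite lerD// csn_expr2.
  by rewrite ler_pXn2r ?nnegrE//; case/andP: (eta01 n).
have dy n : nu (y n.+1 - y n) <= eta n.+1 - eta n.
  elim: n => [|n IH].
    rewrite yS etaS /= subr0 !expr0n/= !addr0 subr0.
    by apply: le_trans (csnZ _ _) _; rewrite half ler_wpM2l ?invr_ge0.
  have -> : y n.+2 - y n.+1 = 2^-1 *: ((y n.+1 - y n) * (y n.+1 + y n)).
    by rewrite (yS n.+1) {2}(yS n) -scalerBr; congr (_ *: _); ring.
  have -> : eta n.+2 - eta n.+1
      = 2^-1 * ((eta n.+1 - eta n) * (eta n.+1 + eta n)).
    by rewrite (etaS n.+1) {2}(etaS n); ring.
  apply: le_trans (csnZ _ _) _; rewrite half ler_wpM2l ?invr_ge0//.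
  apply: le_trans (nuM _ _) _; rewrite ler_pM//.
  by apply: le_trans (nuD _ _) _; rewrite lerD.
(* The increments of [eta] sum to at most 1, so by the Archimedean property they cannot all exceed e
   / 2; no limit is formed. *)
have [n ne] : exists n, eta n.+1 - eta n <= e / 2.
  apply: contrapT => /forallNP H.
  have lin n : n%:R * (e / 2) <= eta n.
    elim: n => [|n IH]; first by rewrite mul0r.
    have /negP := H n; rewrite -ltNge -(natr1 n) => /ltW.
    by move: IH; lra.
  have e20 : 0 < e / 2 by rewrite divr_gt0.
  have e2i : 0 <= (e / 2)^-1 by rewrite invr_ge0 ltW.
  have := lt_le_trans _ (lin (Num.bound (e / 2)^-1)).
  move=> /(_ 1); rewrite -ltr_pdivrMr// mul1r archi_boundP// => /(_ isT).
  by case/andP: (eta01 (Num.bound (e / 2)^-1)) => _; rewrite leNgt => /negPf->.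
(* The defect of this approximate square root is twice an increment: 1 - b - (1 - y_n)^2 = -2
   (y_(n+1) - y_n). *)
exists (1 - y n).
have -> : 1 - b - (1 - y n) ^+ 2 = (-2) *: (y n.+1 - y n).
  rewrite yS scalerBr scalerA (_ : -2 * 2^-1 = -1); last by field.
  by rewrite scaleN1r scaleNr scaler_nat; ring.
apply: le_trans (csnZ _ _) _; rewrite normrN normr_nat.
by have := dy n; lra.
Qed.

(** For a real function f, |L - f| <= L means 0 <= f <= 2L; positivity is thus expressed through the
    seminorm alone. *)
Definition csn_pos p := exists L, nu (L%:P - p) <= L.

Lemma csn_posD p q : csn_pos p -> csn_pos q -> csn_pos (p + q).
Proof.
move=> [L pL] [M qM]; exists (L + M).
rewrite polyCD (_ : _ - _ = (L%:P - p) + (M%:P - q)); last by ring.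
by apply: le_trans (nuD _ _) _; rewrite lerD.
Qed.

Lemma csn_posC c : 0 <= c -> csn_pos c%:P.
Proof. by move=> c0; exists c; rewrite subrr csn0. Qed.

Lemma csn_posB p L : nu p <= L -> csn_pos (L%:P - p).
Proof. by move=> pL; exists L; rewrite subKr. Qed.

Lemma csn_sqrtB b L : nu b <= L -> forall e, 0 < e ->
  exists k, nu (L%:P - b - k ^+ 2) <= e.
Proof.
move=> bL e e0; have L0 : 0 <= L by apply: le_trans bL.
(* The enlarged constant can be divided by even when L = 0, at the cost of an error e / 2. *)
pose L1 := L + e / 2.
have L10 : 0 < L1 by rewrite /L1; lra.
have b1 : nu (L1^-1 *: b) <= 1.
  apply: le_trans (csnZ _ _) _; rewrite ger0_norm ?invr_ge0 ?(ltW L10)//.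
  by rewrite ler_pdivrMl// mulr1 /L1; lra.
have [|k ke] := @csn_sqrt1B _ b1 (e / 2 / L1); first by rewrite !divr_gt0.
exists (Num.sqrt L1 *: k).
rewrite exprZn sqr_sqrtr ?(ltW L10)//.
have -> : L%:P - b - L1 *: k ^+ 2
    = L1 *: (1 - L1^-1 *: b - k ^+ 2) - (e / 2)%:P.
  rewrite !scalerBr scalerA divff ?gt_eqF// scale1r alg_polyC /L1 polyCD.
  by ring.
apply: le_trans (csnB _ _) _.
have e2 : 0 <= e / 2 by rewrite divr_ge0// ltW.
have := csnC_ge0 e2.
have : nu (L1 *: (1 - L1^-1 *: b - k ^+ 2)) <= e / 2.
  apply: le_trans (csnZ _ _) _; rewrite ger0_norm ?(ltW L10)//.
  by rewrite -ler_pdivlMl// mulrC.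
by lra.
Qed.

Lemma csn_pos_sqrt p : csn_pos p -> forall e, 0 < e ->
  exists k, nu (p - k ^+ 2) <= e.
Proof.
move=> [L pL] e e0; have [k ke] := csn_sqrtB pL e0; exists k.
by move: ke; rewrite subKr.
Qed.

(** The constant L = nu p works: if p is close to k^2 and L - k^2 is close to m^2, then m^2 + k^2 is
    close to L, so [csn_sqr] bounds nu(m)^2 by about L, while m^2 is close to L - p. *)
Lemma csn_sqr_pos p : (forall e, 0 < e -> exists k, nu (p - k ^+ 2) <= e) ->
  csn_pos p.
Proof.
move=> pk; exists (nu p); set L := nu p.
apply/ler_addgt0Pr => e e0.
(* Five errors d add up: one each from k^2, from m^2 and from the shift of L to L + d, and two from
   the bound on nu(m)^2. *)
pose d := e / 5; have d0 : 0 < d by rewrite divr_gt0.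
have [k kd] := pk _ d0.
have kL : nu (k ^+ 2) <= L + d.
  rewrite -[k ^+ 2](subKr p); apply: le_trans (csnB _ _) _.
  by rewrite lerD2l.
have [m md] := csn_sqrtB kL d0.
have mL : nu m ^+ 2 <= L + 2 * d.
  apply: le_trans (nu_sqr m k) _.
  have -> : m ^+ 2 + k ^+ 2 = (L + d)%:P - ((L + d)%:P - k ^+ 2 - m ^+ 2).
    by ring.
  apply: le_trans (csnB _ _) _.
  have Ld : 0 <= L + d by rewrite addr_ge0 ?nu_ge0 ?(ltW d0).
  by have := csnC_ge0 Ld; lra.
have -> : L%:P - p = ((L + d)%:P - k ^+ 2 - m ^+ 2) - d%:P - (p - k ^+ 2)
    + m ^+ 2 by rewrite polyCD; ring.
apply: le_trans (nuD _ _) _; rewrite csn_expr2.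
apply: le_trans (lerD (csnB _ _) mL) _.
apply: le_trans (lerD (lerD (csnB _ _) kd) (lexx _)) _.
have := csnC_ge0 (ltW d0); move: md; rewrite /d; lra.
Qed.

Lemma csn_posX2 p : csn_pos (p ^+ 2).
Proof. by apply: csn_sqr_pos => e e0; exists p; rewrite subrr csn0 ltW. Qed.

(** If k^2 and l^2 approximate the two factors, then (k l)^2 approximates their product. *)
Lemma csn_posM p q : csn_pos p -> csn_pos q -> csn_pos (p * q).
Proof.
move=> pp qp; apply: csn_sqr_pos => e e0.
pose B := nu p + nu q + 1.
have B1 : 1 <= B by rewrite /B lerDr addr_ge0 ?nu_ge0.
have B0 : 0 < B by apply: lt_le_trans B1.
pose d := Num.min (e / B) 1.
have d0 : 0 < d by rewrite lt_min ltr01 divr_gt0.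
have [dB d1] : d * B <= e /\ d <= 1.
  by rewrite -ler_pdivlMr// /d; split; rewrite ge_min lexx ?orbT.
have [k kd] := csn_pos_sqrt pp d0; have [l ld] := csn_pos_sqrt qp d0.
exists (k * l).
have -> : p * q - (k * l) ^+ 2 = (p - k ^+ 2) * q + k ^+ 2 * (q - l ^+ 2).
  by ring.
have kL : nu (k ^+ 2) <= nu p + d.
  rewrite -[k ^+ 2](subKr p); apply: le_trans (csnB _ _) _.
  by rewrite lerD2l.
apply: le_trans (nuD _ _) _; apply: le_trans dB.
apply: (@le_trans _ _ (d * nu q + (nu p + d) * d)).
  by rewrite lerD//; apply: le_trans (nuM _ _) _; rewrite ler_pM.
by rewrite /B; nra.
Qed.

(** The product M^2 - p^2 of the two positive polynomials is close to some k^2, so p^2 + k^2 is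
    close to the constant M^2, and [csn_sqr] bounds nu(p)^2. *)
Lemma csn_le_of_pos p M : 0 <= M ->
  csn_pos (M%:P - p) -> csn_pos (M%:P + p) -> nu p <= M.
Proof.
move=> M0 h1 h2; have := csn_posM h1 h2 => /csn_pos_sqrt H.
rewrite -(@ler_pXn2r _ 2)// ?nnegrE//.
apply/ler_addgt0Pr => e e0; have [k ke] := H _ e0.
apply: le_trans (nu_sqr p k) _.
have -> : p ^+ 2 + k ^+ 2
    = (M ^+ 2)%:P - ((M%:P - p) * (M%:P + p) - k ^+ 2).
  by rewrite expr2 polyCM; ring.
apply: le_trans (csnB _ _) _; rewrite lerD//.
by apply: csnC_ge0; rewrite exprn_ge0.
Qed.

Lemma csn_sqr_le p L : 0 <= L -> csn_pos (L%:P - p ^+ 2) -> nu p ^+ 2 <= L.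
Proof.
move=> L0 /csn_pos_sqrt H; apply/ler_addgt0Pr => e e0; have [k ke] := H _ e0.
apply: le_trans (nu_sqr p k) _.
have -> : p ^+ 2 + k ^+ 2 = L%:P - (L%:P - p ^+ 2 - k ^+ 2) by ring.
by apply: le_trans (csnB _ _) _; rewrite lerD// csnC_ge0.
Qed.

(* Factor p over R: a positive p splits into squares plus constants and linear
   factors whose root lies outside the interval. *)
Lemma csn_pos_interval (rho : R) p : nu 'X <= rho ->
  (forall x, `|x| <= rho -> 0 < p.[x]) -> csn_pos p.
Proof.
move=> nuX; have rho0 : 0 <= rho by apply: le_trans nuX.
elim: {p}(size p) {-2}p (leqnn (size p)) => [p|n IH p].
  rewrite leqn0 size_poly_eq0 => /eqP-> /(_ 0).
  by rewrite normr0 horner0 ltxx => /(_ rho0).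
move=> pn ppos.
pose pC := map_poly (real_complex R) p.
have [p1|p1] := leqP (size p) 1.
  move: ppos; rewrite (size1_polyC p1) => /(_ 0).
  by rewrite normr0 hornerC => /(_ rho0)/ltW; exact: csn_posC.
have [z rz] : exists z, root pC z.
  by apply/closed_rootP; rewrite size_map_poly gtn_eqF.
have p0 : p != 0 by rewrite -size_poly_gt0 ltnW.
have [z0|z0] := eqVneq (Im z) 0.
  have zE : z = (Re z)%:C by rewrite [LHS]complexE z0 mulr0 addr0.
  have rp : root p (Re z).
    by move: rz; rewrite zE fmorph_root.
  have /factor_theorem[q pE] := rp.
  have q0 : q != 0 by apply: contra_neq p0 => q0; rewrite pE q0 mul0r.
  have sq : (size q <= n)%N.
    by move: pn; rewrite pE size_Mmonic ?monicXsubC// size_XsubC addn2.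
  have rz_out : rho < `|Re z|.
    rewrite ltNge; apply/negP => /ppos.
    by move/rootP: rp => ->; rewrite ltxx.
  (* Up to sign, the linear factor is the constant [|Re z| - rho] plus rho - X or rho + X; the
     constant is positive since the root lies outside the interval, the other summand since nu(X) <=
     rho. *)
  have [z_ge0|z_lt0] := leP 0 (Re z).
    rewrite ger0_norm// in rz_out.
    have -> : p = (- q) * ((Re z - rho)%:P + (rho%:P - 'X)).
      by rewrite pE polyCB; ring.
    apply: csn_posM; last first.
      apply: csn_posD; first by apply: csn_posC; lra.
      exact: csn_posB.
    apply: IH => [|x xr]; first by rewrite size_polyN.
    have := ppos x xr; rewrite pE hornerM hornerXsubC hornerN.
    have : x - Re z < 0 by have := ler_norm x; lra.
    by nra.
  rewrite ltr0_norm// in rz_out.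
  have -> : p = q * ((- Re z - rho)%:P + (rho%:P - (- 'X))).
    by rewrite pE polyCB polyCN; ring.
  apply: csn_posM; last first.
    apply: csn_posD; first by apply: csn_posC; lra.
    by apply: csn_posB; rewrite csnN.
  apply: IH => // x xr.
  have := ppos x xr; rewrite pE hornerM hornerXsubC.
  have : 0 < x - Re z by have := ler_norm (- x); rewrite normrN; lra.
  by nra.
(* The real quadratic with roots z and its conjugate is a square plus a positive constant. *)
pose m := ('X - (Re z)%:P) ^+ 2 + (Im z ^+ 2)%:P.
have im0 : 0 < Im z ^+ 2 by rewrite exprn_even_gt0.
have sm : size m = 3.
  rewrite size_polyDl size_exp_XsubC// size_polyC.
  by case: (_ == _).
have m0 : m != 0 by rewrite -size_poly_gt0 sm.
have mz : (map_poly (real_complex R) m).[z] = 0.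
  rewrite rmorphD rmorphXn rmorphB /= map_polyX !map_polyC /=.
  rewrite !hornerE {1}[z]complexE.
  by rewrite addrAC subrr add0r exprMn sqr_i rmorphXn /= mulN1r addNr.
pose u := p %% m; pose q := p %/ m.
have pE : p = q * m + u by exact: divp_eq.
have su : (size u <= 2)%N.
  by have := ltn_modpN0 p m0; rewrite sm ltnS.
(* A real polynomial of degree at most 1 that vanishes at a non-real point is zero. *)
have u0 : u = 0.
  have uz : (map_poly (real_complex R) u).[z] = 0.
    move: rz => /rootP; rewrite /pC pE rmorphD rmorphM /= hornerD hornerM mz.
    by rewrite mulr0 add0r.
  have uE : u = u`_1 *: 'X + (u`_0)%:P.
    apply/polyP => -[|[|i]]; rewrite !coefE ?mulr0 ?add0r ?mulr1 ?addr0//.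
    by rewrite nth_default// (leq_trans su).
  move: uz; rewrite uE rmorphD /= map_polyZ map_polyX map_polyC /= !hornerE.
  rewrite [z]complexE => /eqP; rewrite eq_complex /= => /andP[/eqP e1 /eqP e2].
  have u1 : u`_1 = 0.
    apply: (mulIf z0); rewrite mul0r -[RHS]e2.
    by ring.
  move: e1; rewrite u1 scale0r add0r => e1.
  rewrite (_ : u`_0 = 0) ?addr0//.
  by move: e1; rewrite !mul0r subr0 add0r.
rewrite {}u0 addr0 in pE.
have mpos x : 0 < m.[x].
  by rewrite /m !hornerE ltr_wpDl// sqr_ge0.
rewrite pE; apply: csn_posM; last first.
  by apply: csn_posD; [exact: csn_posX2|apply/csn_posC/ltW].
have q0 : q != 0 by apply: contra_neq p0 => q0; rewrite pE q0 mul0r.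
apply: IH => [|x xr].
  by move: pn; rewrite pE size_mul// sm addn3 /= => /ltnW.
by have := ppos x xr; rewrite pE hornerM pmulr_lgt0.
Qed.

(** The margin e makes M + e - p and M + e + p strictly positive on the interval, as the
    factorization argument requires. *)
Lemma csn_le_sup (rho : R) p M : nu 'X <= rho ->
  (forall x, `|x| <= rho -> `|p.[x]| <= M) -> nu p <= M.
Proof.
move=> nuX pM; have rho0 : 0 <= rho by apply: le_trans nuX.
have M0 : 0 <= M by apply: le_trans (pM 0 _); rewrite ?normr0.
apply/ler_addgt0Pr => e e0; apply: csn_le_of_pos.
    by rewrite addr_ge0// ltW.
  apply: (csn_pos_interval nuX) => x /pM; rewrite !hornerE => H.
  by have := ler_norm p.[x]; lra.
apply: (csn_pos_interval nuX) => x /pM; rewrite !hornerE => H.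
by have := ler_norm (- p.[x]); rewrite normrN; lra.
Qed.

End CstarSeminorm.

(** * The unitization *)

Section CstarNorm.
Variables (R : realType) (B : cstarAlgType R).
Implicit Types x y z : B.

(** The norm takes values in [R[i]]; its real part makes the order and the square roots of [R]
    available. *)
Definition nrm (x : B) : R := Re `|x|.

Lemma nrmE x : `|x| = (nrm x)%:C.
Proof. by rewrite /nrm RRe_real// normr_real. Qed.

Lemma nrm_ge0 x : 0 <= nrm x.
Proof. by rewrite -ler_real_complex -nrmE normr_ge0. Qed.

Lemma nrmD x y : nrm (x + y) <= nrm x + nrm y.
Proof. by rewrite -ler_real_complex rmorphD /= -!nrmE ler_normD. Qed.

Lemma nrmZ (c : R[i]) x : nrm (c *: x) = normc c * nrm x.
Proof. by apply: complexI; rewrite rmorphM /= -!nrmE normrZ normcR. Qed.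

Lemma nrmM x y : nrm (x ** y) <= nrm x * nrm y.
Proof. by rewrite -ler_real_complex rmorphM /= -!nrmE cnormM. Qed.

Lemma nrm_starM x : nrm (x^** ** x) = nrm x ^+ 2.
Proof. by apply: complexI; rewrite rmorphXn /= -!nrmE cnorm_star. Qed.

Lemma nrm0 : nrm 0 = 0.
Proof. by apply: complexI; rewrite -nrmE normr0. Qed.

Lemma nrm_eq0 x : nrm x = 0 -> x = 0.
Proof. by move=> x0; apply: normr0_eq0; rewrite nrmE x0. Qed.

Lemma nrm_star x : nrm x^** = nrm x.
Proof.
have le y : nrm y <= nrm y^**.
  have [->|y0] := eqVneq (nrm y) 0; first exact: nrm_ge0.
  have yp : 0 < nrm y by rewrite lt_def y0 nrm_ge0.
  by rewrite -(ler_pM2r yp) -expr2 -nrm_starM nrmM.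
by apply/eqP; rewrite eq_le le -{2}[x]starK le.
Qed.

Lemma cmul0l x : 0 ** x = 0.
Proof. by rewrite -(scale0r (0 : B)) cmulZl !scale0r. Qed.

Lemma cmul0r x : x ** 0 = 0.
Proof. by rewrite -(scale0r (0 : B)) cmulZr !scale0r. Qed.

Lemma cmulNl x y : (- x) ** y = - (x ** y).
Proof. by rewrite -(scaleN1r x) cmulZl scaleN1r. Qed.

Lemma cmulNr x y : x ** (- y) = - (x ** y).
Proof. by rewrite -(scaleN1r y) cmulZr scaleN1r. Qed.

Lemma starN x : (- x)^** = - x^**.
Proof. by rewrite -(scaleN1r x) starZ rmorphN1 scaleN1r. Qed.

Lemma star0 : (0 : B)^** = 0.
Proof. by apply: (addrI (star 0)); rewrite -starD !addr0. Qed.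

End CstarNorm.

(** The pair (a, x) stands for a + x. A new unit is adjoined even if [B] already has one. *)
Definition unitization (R : realType) (B : cstarAlgType R) : Type :=
  (R[i]^o * B)%type.

Section UnitizationRing.
Variables (R : realType) (B : cstarAlgType R).
Local Notation U := (unitization B).
HB.instance Definition _ := GRing.Lmodule.copy U (R[i]^o * B)%type.

Let umul (X Y : U) : U :=
  ((X.1 : R[i]) * Y.1, (X.1 : R[i]) *: Y.2 + (Y.1 : R[i]) *: X.2 + X.2 ** Y.2).
Let uone : U := (1, 0).

Let umulA : associative umul.
Proof.
move=> [a x] [b y] [c z]; congr pair; rewrite /=; first by rewrite mulrA.
rewrite !scalerDr !scalerA !cmulDl !cmulDr !cmulZl !cmulZr cmulA !addrA.
rewrite [c * a]mulrC [c * b]mulrC.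
by rewrite [LHS](ACl (1*2*4*6*3*5*7)).
Qed.
Let umul1 : left_id uone umul.
Proof.
by move=> [a x]; rewrite /umul /= mul1r scale1r scaler0 cmul0l !addr0.
Qed.
Let umulr1 : right_id uone umul.
Proof.
by move=> [a x]; rewrite /umul /= mulr1 scale1r scaler0 cmul0r add0r addr0.
Qed.
Let umulDl : left_distributive umul +%R.
Proof.
move=> [a x] [b y] [c z]; congr pair; rewrite /=; first exact: mulrDl.
by rewrite scalerDl scalerDr cmulDl !addrA [LHS](ACl (1*3*5*2*4*6)).
Qed.
Let umulDr : right_distributive umul +%R.
Proof.
move=> [a x] [b y] [c z]; congr pair; rewrite /=; first exact: mulrDr.
by rewrite scalerDl scalerDr cmulDr !addrA [LHS](ACl (1*3*5*2*4*6)).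
Qed.
Let uone_neq0 : uone != 0.
Proof. by apply/eqP => -[/eqP]; rewrite oner_eq0. Qed.

HB.instance Definition _ := GRing.Zmodule_isNzRing.Build U
  umulA umul1 umulr1 umulDl umulDr uone_neq0.

Let uscaleAl (c : R[i]) (X Y : U) : c *: (X * Y) = (c *: X) * Y.
Proof.
case: X Y => [a x] [b y]; congr pair; rewrite /=; first exact: mulrA.
by rewrite !scalerDr !scalerA cmulZl [b * c]mulrC.
Qed.
HB.instance Definition _ := GRing.Lmodule_isLalgebra.Build R[i] U uscaleAl.
Let uscaleAr (c : R[i]) (X Y : U) : c *: (X * Y) = X * (c *: Y).
Proof.
case: X Y => [a x] [b y]; congr pair; rewrite /=; first exact: mulrCA.
by rewrite !scalerDr !scalerA cmulZr [a * c]mulrC.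
Qed.
HB.instance Definition _ := GRing.Lalgebra_isAlgebra.Build R[i] U uscaleAr.

Definition uinj (x : B) : U := (0, x).
Definition ustar (X : U) : U := ((X.1 : R[i])^*, X.2^**).
Definition uact (X : U) (z : B) : B := (X.1 : R[i]) *: z + X.2 ** z.

Lemma uinjD x y : uinj (x + y) = uinj x + uinj y.
Proof. by congr pair; rewrite /= addr0. Qed.

Lemma uinjZ (c : R[i]) x : uinj (c *: x) = c *: uinj x.
Proof. by congr pair; rewrite /= scaler0. Qed.

Lemma uinjM x y : uinj (x ** y) = uinj x * uinj y.
Proof. by congr pair; rewrite /= ?mulr0 // !scale0r !add0r. Qed.

Lemma uinj_star x : uinj x^** = ustar (uinj x).
Proof. by congr pair; rewrite /= ?rmorph0. Qed.

Lemma ustarK : involutive ustar.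
Proof. by move=> [a x]; rewrite /ustar /= conjCK starK. Qed.

Lemma ustarD : {morph ustar : X Y / X + Y}.
Proof. by move=> [a x] [b y]; rewrite /ustar /= rmorphD starD. Qed.

Lemma ustarZ (c : R[i]) X : ustar (c *: X) = c^* *: ustar X.
Proof.
by case: X => a x; rewrite /ustar /= starZ; congr pair; exact: rmorphM.
Qed.

Lemma ustarN X : ustar (- X) = - ustar X.
Proof. by rewrite -(scaleN1r X) ustarZ rmorphN1 scaleN1r. Qed.

Lemma ustarM X Y : ustar (X * Y) = ustar Y * ustar X.
Proof.
case: X Y => [a x] [b y]; congr pair; rewrite /=.
  by rewrite [RHS]mulrC; exact: rmorphM.
by rewrite !starD !starZ starM [X in X + _ = _]addrC.
Qed.

Lemma ustar1 : ustar 1 = 1.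
Proof. by congr pair; rewrite /= ?rmorph1 ?star0. Qed.

Lemma uactD X Y z : uact (X + Y) z = uact X z + uact Y z.
Proof. by rewrite /uact /= scalerDl cmulDl addrACA. Qed.

Lemma uactM X Y z : uact (X * Y) z = uact X (uact Y z).
Proof.
by rewrite /uact /= !scalerDr !cmulDl !cmulZl cmulDr cmulZr scalerA cmulA !addrA.
Qed.

Lemma uactZ (c : R[i]) X z : uact (c *: X) z = c *: uact X z.
Proof. by rewrite /uact /= scalerDr scalerA cmulZl. Qed.

Lemma uact1 z : uact 1 z = z.
Proof. by rewrite /uact /= scale1r cmul0l addr0. Qed.

Lemma uact_inj x z : uact (uinj x) z = x ** z.
Proof. by rewrite /uact /= scale0r add0r. Qed.

Lemma uact_scale X (c : R[i]) z : uact X (c *: z) = c *: uact X z.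
Proof. by rewrite /uact /= scalerDr !scalerA cmulZr mulrC. Qed.

Lemma uact_adj X y z : y^** ** uact X z = (uact (ustar X) y)^** ** z.
Proof.
by rewrite /uact /= cmulDr cmulZr starD starZ starM starK conjCK cmulDl cmulZl
  cmulA.
Qed.

End UnitizationRing.

(** * The operator seminorm on the unitization *)

Section UnitizationNorm.
Variables (R : realType) (B : cstarAlgType R).
Local Notation U := (unitization B).
Implicit Types X Y : U.

(** This is the norm of left multiplication on [B]. It is only a seminorm on the unitization: if [B]
    has a unit e, then (1, -e) acts as zero. On [B] itself it agrees with the norm. *)
Definition unorm X : R := sup [set nrm (uact X z) | z in [set z | nrm z <= 1]].

Lemma nrm_uact_bounded X z : nrm (uact X z) <= (normc X.1 + nrm X.2) * nrm z.
Proof.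
by apply: le_trans (nrmD _ _) _; rewrite mulrDl lerD ?nrmM// nrmZ.
Qed.

Lemma unorm_ub X z : nrm z <= 1 -> nrm (uact X z) <= unorm X.
Proof.
move=> z1; apply: ub_le_sup; last by exists z.
exists (normc X.1 + nrm X.2) => _ [y y1 <-].
apply: le_trans (nrm_uact_bounded _ _) _.
by rewrite ler_piMr// addr_ge0 ?normc_ge0 ?nrm_ge0.
Qed.

Lemma unorm_ge0 X : 0 <= unorm X.
Proof. by apply: le_trans (@unorm_ub X 0 _); rewrite ?nrm_ge0// nrm0 ler01. Qed.

Lemma unorm_le X c : 0 <= c -> (forall z, nrm (uact X z) <= c * nrm z) ->
  unorm X <= c.
Proof.
move=> c0 Xc; apply: ge_sup => [|_ [z z1 <-]].
  by exists (nrm (uact X 0)), 0; rewrite //= nrm0 ler01.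
by apply: le_trans (Xc z) _; rewrite ler_piMr.
Qed.

Lemma nrm_uact_le X z : nrm (uact X z) <= unorm X * nrm z.
Proof.
have [/nrm_eq0->|z0] := eqVneq (nrm z) 0.
  by apply: le_trans (nrm_uact_bounded _ _) _; rewrite nrm0 !mulr0.
have zp : 0 < nrm z by rewrite lt_def z0 nrm_ge0.
have normcl : normc (nrm z)^-1%:C = (nrm z)^-1.
  by rewrite /= expr0n addr0 sqrtr_sqr ger0_norm// invr_ge0 ltW.
have := @unorm_ub X ((nrm z)^-1%:C *: z).
by rewrite uact_scale !nrmZ normcl mulVf// lexx => /(_ isT);
  rewrite ler_pdivrMl// mulrC.
Qed.

Lemma unormD X Y : unorm (X + Y) <= unorm X + unorm Y.
Proof.
apply: unorm_le => [|z]; first by rewrite addr_ge0 ?unorm_ge0.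
rewrite uactD; apply: le_trans (nrmD _ _) _.
by rewrite mulrDl lerD ?nrm_uact_le.
Qed.

Lemma unormM X Y : unorm (X * Y) <= unorm X * unorm Y.
Proof.
apply: unorm_le => [|z]; first by rewrite mulr_ge0 ?unorm_ge0.
rewrite uactM; apply: le_trans (nrm_uact_le _ _) _.
by rewrite -mulrA ler_wpM2l ?unorm_ge0 ?nrm_uact_le.
Qed.

Lemma unormZ (c : R[i]) X : unorm (c *: X) <= normc c * unorm X.
Proof.
apply: unorm_le => [|z]; first by rewrite mulr_ge0 ?unorm_ge0 ?normc_ge0.
by rewrite uactZ nrmZ -mulrA ler_wpM2l ?normc_ge0 ?nrm_uact_le.
Qed.

Lemma unormA (c : R[i]) : unorm c%:A <= normc c.
Proof.
by apply: unorm_le => [|z]; rewrite ?normc_ge0// uactZ uact1 nrmZ.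
Qed.

Lemma unorm_inj_le x : unorm (uinj x) <= nrm x.
Proof. by apply: unorm_le => [|z]; rewrite ?nrm_ge0// uact_inj nrmM. Qed.

(** Left multiplication by x attains its norm in the direction x*, since x x* has norm the square of
    that of x. *)
Lemma unorm_inj_ge x : nrm x <= unorm (uinj x).
Proof.
have [->|x0] := eqVneq (nrm x) 0; first exact: unorm_ge0.
have xp : 0 < nrm x by rewrite lt_def x0 nrm_ge0.
have := nrm_uact_le (uinj x) x^**.
rewrite uact_inj -{1}[x]starK nrm_starM nrm_star expr2.
by rewrite ler_pM2r.
Qed.

(** [B] serves as a Hilbert module over itself with inner product y* z, for which [ustar] is the
    adjoint: the squared norm of Xz is the norm of z* (X* X z). *)
Lemma unorm_starM_ge X : unorm X ^+ 2 <= unorm (ustar X * X).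
Proof.
rewrite -[leRHS]sqr_sqrtr ?unorm_ge0// ler_pXn2r ?nnegrE ?unorm_ge0//;
  last exact: sqrtr_ge0.
apply: unorm_le => [|z]; first exact: sqrtr_ge0.
rewrite -(@ler_pXn2r _ 2)// ?nnegrE ?mulr_ge0 ?nrm_ge0 ?sqrtr_ge0//.
rewrite exprMn sqr_sqrtr ?unorm_ge0// -nrm_starM -{1}[X]ustarK -uact_adj -uactM.
apply: le_trans (nrmM _ _) _; rewrite nrm_star expr2 mulrA mulrC.
by rewrite ler_wpM2r ?nrm_ge0 ?nrm_uact_le.
Qed.

Lemma unorm_star X : unorm (ustar X) = unorm X.
Proof.
have le Y : unorm Y <= unorm (ustar Y).
  have [->|Y0] := eqVneq (unorm Y) 0; first exact: unorm_ge0.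
  have Yp : 0 < unorm Y by rewrite lt_def Y0 unorm_ge0.
  rewrite -(ler_pM2r Yp) -expr2.
  exact: le_trans (unorm_starM_ge _) (unormM _ _).
by apply/eqP; rewrite eq_le le -{2}[X]ustarK le.
Qed.

(* For commuting self-adjoint S and T, S is the real part of the normal element
   S + iT, and (S + iT)* (S + iT) = S^2 + T^2. *)
Lemma unorm_sqr_le X Y : ustar X = X -> ustar Y = Y -> X * Y = Y * X ->
  unorm X ^+ 2 <= unorm (X * X + Y * Y).
Proof.
move=> Xs Ys XY; pose W := X + 'i%C *: Y.
have Ws : ustar W = X - 'i%C *: Y.
  rewrite ustarD ustarZ Xs Ys (_ : 'i%C^* = - 'i%C) ?scaleNr//.
  by apply/eqP; rewrite eq_complex /= oppr0 !eqxx.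
have WW : ustar W * W = X * X + Y * Y.
  rewrite Ws mulrBl !mulrDr -!scalerAl -!scalerAr scalerA -[_ * 'i%C]expr2.
  rewrite sqr_i scaleN1r -XY opprD opprK addrA; congr (_ + _).
  by rewrite addrK.
rewrite -WW; apply: le_trans (unorm_starM_ge W).
rewrite ler_pXn2r ?nnegrE ?unorm_ge0//.
have -> : X = (2^-1)%:C *: (W + ustar W).
  rewrite Ws addrACA subrr addr0 -mulr2n -[X *+ 2](scaler_nat 2) scalerA.
  rewrite (_ : _%:C * _ = 1) ?scale1r//.
  by apply/eqP; rewrite eq_complex /=; apply/andP; split; apply/eqP; field.
apply: le_trans (unormZ _ _) _.
apply: le_trans (ler_wpM2l (normc_ge0 _) (unormD _ _)) _.
rewrite unorm_star /= expr0n addr0 sqrtr_sqr ger0_norm ?invr_ge0//.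
by lra.
Qed.

End UnitizationNorm.

(** * Polynomials in a self-adjoint element *)

Section SelfAdjointCalculus.
Variables (R : realType) (B : cstarAlgType R).
Local Notation U := (unitization B).
Local Notation RC := (real_complex R).
Variable W : U.
Hypothesis Ws : ustar W = W.

Lemma ustar_horner (P : {poly R[i]}) :
  ustar (horner_alg W P) = horner_alg W (map_poly conjc P).
Proof.
elim/poly_ind: P => [|P c IH].
  by rewrite !rmorph0 -{1}(scale0r (1 : U)) ustarZ rmorph0 scale0r.
rewrite rmorphD rmorphM /= horner_algX horner_algC ustarD ustarM ustarZ ustar1.
rewrite IH Ws [in RHS]rmorphD /= [in RHS]rmorphM /= map_polyX map_polyC /=.
rewrite rmorphD rmorphM /= horner_algX horner_algC; congr (_ + _).
set Pc := map_poly _ P; transitivity (horner_alg W ('X * Pc)).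
  by rewrite rmorphM /= horner_algX.
by rewrite mulrC rmorphM /= horner_algX.
Qed.

Lemma ustar_horner_real (p : {poly R}) :
  ustar (horner_alg W (map_poly RC p)) = horner_alg W (map_poly RC p).
Proof.
rewrite ustar_horner -map_poly_comp; congr (horner_alg W _).
by apply: eq_map_poly => x /=; rewrite /= oppr0.
Qed.

Lemma horner_cstar_seminorm :
  cstar_seminorm (fun p => unorm (horner_alg W (map_poly RC p))).
Proof.
split=> [p|p q|p q|c|p q].
- exact: unorm_ge0.
- by rewrite !rmorphD unormD.
- by rewrite !rmorphM unormM.
- rewrite map_polyC /= horner_algC; apply: le_trans (unormA _ _) _.
  by rewrite /= expr0n addr0 sqrtr_sqr.
- rewrite !rmorphD !rmorphXn /= !expr2; apply: unorm_sqr_le.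
  + exact: ustar_horner_real.
  + exact: ustar_horner_real.
  + by rewrite -!rmorphM mulrC.
Qed.

(** On the real line |P|^2 is the real polynomial (Re P)^2 + (Im P)^2, with parts taken
    coefficientwise. Through it the bound for real polynomials reaches complex ones. *)
Lemma horner_normsq (P : {poly R[i]}) : exists q : {poly R},
  map_poly RC q = map_poly conjc P * P /\
  forall x, q.[x] = normc P.[x%:C] ^+ 2.
Proof.
pose q := (map_poly (@Re R) P) ^+ 2 + (map_poly (@Im R) P) ^+ 2.
have qE : map_poly RC q = map_poly conjc P * P.
  pose A := map_poly RC (map_poly (@Re R) P).
  pose C := map_poly RC (map_poly (@Im R) P).
  have PE : P = A + 'i%C *: C.
    by apply/polyP => j; rewrite coefD coefZ !coef_map_id0//= -complexE.
  have PcE : map_poly conjc P = A - 'i%C *: C.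
    apply/polyP => j; rewrite coefB coefZ !coef_map_id0//= ?oppr0//.
    by case: (P`_j) => a b /=; simpc.
  rewrite PcE [X in _ * X]PE /q rmorphD !rmorphXn -/A -/C.
  rewrite mulrBl !mulrDr -!scalerAl -!scalerAr scalerA.
  rewrite -[_ * 'i%C]expr2 sqr_i scaleN1r.
  by rewrite opprD opprK addrA [C * A]mulrC addrK -!expr2.
exists q; split=> // x.
apply: (@complexI R); rewrite -[LHS](horner_map RC) qE hornerM.
rewrite rmorphXn /= -normcR sqr_normc [RHS]mulrC; congr (_ * _).
have xJ : conjc x%:C = x%:C by rewrite /= oppr0.
by rewrite -[in LHS]xJ (horner_map conjc).
Qed.

(** The weight [g] is 1 when P(w) is estimated, and 1 + x^2 when Z S(w) is, because Z^2 = 1 +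
    w^2. *)
Lemma unorm_horner_normsq_le (rho M : R) (g : {poly R}) (P : {poly R[i]}) :
  unorm W <= rho ->
  (forall x, `|x| <= rho -> `|g.[x] * normc P.[x%:C] ^+ 2| <= M) ->
  unorm (horner_alg W (map_poly conjc P * map_poly RC g * P)) <= M.
Proof.
move=> Wr gM; have [q [qE qx]] := horner_normsq P.
have -> : map_poly conjc P * map_poly RC g * P = map_poly RC (g * q).
  by rewrite rmorphM /= qE mulrAC mulrC.
apply: (@csn_le_sup _ _ horner_cstar_seminorm rho).
  by rewrite map_polyX horner_algX.
by move=> x /gM; rewrite hornerM qx.
Qed.

End SelfAdjointCalculus.

(** * An idempotent and its adjoint *)

Section IdempotentInUnitization.
Variables (R : realType) (B : cstarAlgType R).
Local Notation U := (unitization B).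
Local Notation RC := (real_complex R).
Variable E : U.
Hypothesis Eidem : E * E = E.
Local Notation F := (ustar E).

Definition skew_part : U := 'i%C *: (E - F).
Definition sym_part : U := E + F - 1.
Local Notation w := skew_part.
Local Notation Z := sym_part.

Lemma sym_part_star : ustar Z = Z.
Proof. by rewrite !ustarD ustarK ustarN ustar1 [F + E]addrC. Qed.

Lemma skew_part_star : ustar w = w.
Proof.
rewrite ustarZ ustarD ustarN ustarK.
rewrite (_ : 'i%C^* = - 'i%C) ?scaleNr -?scalerN ?opprB//.
by apply/eqP; rewrite eq_complex /= oppr0 !eqxx.
Qed.

Lemma star_idem : F * F = F.
Proof. by rewrite -ustarM Eidem. Qed.

Lemma skew_part_sqr : w * w = E * F + F * E - E - F.
Proof.
rewrite /w -scalerAl -scalerAr scalerA -[_ * 'i%C]expr2 sqr_i scaleN1r.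
rewrite mulrBl !mulrBr Eidem star_idem !opprD !opprK.
by rewrite !addrA [LHS](ACl (2*3*1*4)).
Qed.

Lemma sym_part_sqr : Z * Z = 1 + w * w.
Proof.
rewrite skew_part_sqr /Z mulrBl mul1r mulrDl !mulrBr !mulrDr !mulr1.
rewrite Eidem star_idem (addrC E (E * F)) !addrK opprB addrCA opprD.
by rewrite !addrA.
Qed.

Lemma sym_skew_anticomm : Z * w = - (w * Z).
Proof.
rewrite /w /Z -scalerAl -scalerAr -scalerN; congr (_ *: _).
rewrite mulrBl mul1r [(E - F) * _]mulrBr mulr1 mulrDl !mulrBr mulrBl !mulrDr.
rewrite Eidem star_idem !opprD !opprK !addrA.
rewrite [LHS](ACl ((1*5)*(4*6)*2*3)) [RHS](ACl ((1*5)*(4*6)*2*3)) /=.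
by rewrite !subrr !addNr.
Qed.

Lemma idem_decomp : E = (2^-1)%:C *: (1 + Z - 'i%C *: w).
Proof.
rewrite /w scalerA -[_ * 'i%C]expr2 sqr_i scaleN1r opprK /Z.
have -> : 1 + (E + F - 1) + (E - F) = E *+ 2.
  by rewrite [1 + _]addrC subrK addrACA subrr addr0 mulr2n.
rewrite -[E *+ 2](scaler_nat 2) scalerA (_ : _%:C * _ = 1) ?scale1r//.
by apply/eqP; rewrite eq_complex /=; apply/andP; split; apply/eqP; field.
Qed.

Lemma one_skew_sqr_mulE : (1 + w * w) * E = E * (F * E).
Proof.
rewrite skew_part_sqr mulrDl mul1r !mulrBl mulrDl -!mulrA Eidem.
by rewrite !addrA [LHS](ACl ((1*4)*(3*5)*2)) /= !subrr !add0r.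
Qed.

Lemma one_skew_sqr_mulF : (1 + w * w) * F = F * (E * F).
Proof.
rewrite skew_part_sqr mulrDl mul1r !mulrBl mulrDl -!mulrA star_idem.
by rewrite !addrA [LHS](ACl ((1*5)*(2*4)*3)) /= !subrr !add0r.
Qed.

Variable r : R.
Hypothesis r1 : 1 < r.
Hypothesis Er : unorm E <= r.

Let r0 : 0 < r. Proof. by apply: lt_trans r1. Qed.

Let Fr : unorm F <= r. Proof. by rewrite unorm_star. Qed.

(** Each factor 1 + w^2 to the left of G is traded for H G on its right, which costs r^2. *)
Let pow_mul_le j G H : (1 + w * w) * G = G * (H * G) ->
  unorm G <= r -> unorm H <= r ->
  unorm ((1 + w * w) ^+ j * G) <= r * r ^+ (2 * j).
Proof.
move=> GH Gr Hr; elim: j => [|j IH].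
  by rewrite mul1r muln0 expr0 mulr1.
rewrite exprSr -mulrA GH mulrA; apply: le_trans (unormM _ _) _.
have -> : r * r ^+ (2 * j.+1) = r * r ^+ (2 * j) * r ^+ 2.
  by rewrite mulnS exprD; ring.
rewrite ler_pM ?unorm_ge0//; apply: le_trans (unormM _ _) _.
by rewrite expr2 ler_pM ?unorm_ge0.
Qed.

(** One factor is expanded as 1 + EF + FE - E - F. After multiplication by (1 + w^2)^N, each of the
    last four terms has norm at most r^(2N+2), so every step adds 4 such powers and the bound grows
    by a linear factor only. *)
Lemma unorm_one_skew_pow_le N :
  unorm ((1 + w * w) ^+ N) <= 1 + N%:R * 4 * (r ^+ 2) ^+ N.
Proof.
elim: N => [|N IH].
  rewrite expr0 !mul0r addr0 -(scale1r (1 : U)).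
  by apply: le_trans (unormA _ _) _; rewrite normc1.
have PE := @pow_mul_le N E F one_skew_sqr_mulE Er Fr.
have PF := @pow_mul_le N F E one_skew_sqr_mulF Fr Er.
rewrite exprM in PE PF; rewrite exprSr [X in _ * (1 + X)]skew_part_sqr.
set P := (1 + w * w) ^+ N in PE PF IH *; set y := (r ^+ 2) ^+ N in PE PF IH.
have y0 : 0 <= y by rewrite exprn_ge0// exprn_ge0// ltW.
have uN X Y : unorm (X - Y : U) <= unorm X + unorm Y.
  apply: le_trans (unormD _ _) _; rewrite lerD2l -scaleN1r.
  by apply: le_trans (unormZ _ _) _; rewrite normcN normc1 mul1r.
rewrite mulrDr mulr1 !mulrBr mulrDr !mulrA.
apply: le_trans (unormD _ _) _.
have PEF : unorm (P * E * F) <= r * y * r.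
  by apply: le_trans (unormM _ _) _; rewrite ler_pM ?unorm_ge0.
have PFE : unorm (P * F * E) <= r * y * r.
  by apply: le_trans (unormM _ _) _; rewrite ler_pM ?unorm_ge0.
apply: le_trans (lerD (lexx _) (uN _ _)) _.
apply: le_trans (lerD (lexx _) (lerD (uN _ _) (lexx _))) _.
apply: le_trans (lerD (lexx _) (lerD (lerD (unormD _ _) (lexx _)) (lexx _))) _.
rewrite exprS -/y -(natr1 N).
have ry : r * y <= r * y * r by rewrite ler_peMr ?mulr_ge0 ?(ltW r0) ?(ltW r1).
have r21 : 1 <= r ^+ 2 by rewrite exprn_ege1// ltW.
have Ny : N%:R * 4 * y <= N%:R * 4 * (r ^+ 2 * y).
  by rewrite ler_wpM2l ?mulr_ge0// ler_peMl.
apply: le_trans (lerD IH (lerD (lerD (lerD PEF PFE) PE) PF)) _.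
rewrite !mulrDl; nra.
Qed.

(** The power trick removes the linear factor and leaves r^2 as a bound for 1 + w^2. The 1 is then
    subtracted by positivity of r^2 - (1 + w^2), which the triangle inequality would not allow. *)
Lemma unorm_skew_part_le : unorm w <= Num.sqrt (r ^+ 2 - 1).
Proof.
have nuP := horner_cstar_seminorm skew_part_star.
set nu := (fun p => _) in nuP.
have nuX : nu (1 + 'X * 'X) = unorm (1 + w * w).
  by rewrite /nu rmorphD rmorphM rmorph1 /= map_polyX rmorphD rmorph1 rmorphM
    /= horner_algX.
have le_r2 : nu (1 + 'X * 'X) <= r ^+ 2.
  apply: (@le_of_pow_le_linear _ _ _ 4) => // [|k].
    by rewrite exprn_ege1// ltW.
  rewrite -(csn_expr_pow2 nuP) /nu !rmorphXn.
  rewrite -/(nu (1 + 'X * 'X)) in nuX *.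
  have := unorm_one_skew_pow_le (2 ^ k).
  by rewrite rmorphD rmorphM rmorph1 /= map_polyX rmorphD rmorph1 rmorphM
    /= horner_algX.
have r2 : 0 <= r ^+ 2 - 1 by rewrite subr_ge0 exprn_ege1// ltW.
have : nu 'X ^+ 2 <= r ^+ 2 - 1.
  apply: (csn_sqr_le nuP) => //.
  have := csn_posB le_r2; congr csn_pos.
  by rewrite polyCB; ring.
rewrite /nu map_polyX horner_algX => H.
by rewrite -(@ler_pXn2r _ 2)// ?nnegrE ?unorm_ge0 ?sqrtr_ge0// sqr_sqrtr.
Qed.

End IdempotentInUnitization.

(** * *-homomorphisms from bounded graphs *)

Section PairNorm.
Variables (R : realType) (A B : cstarAlgType R).
Implicit Types x y : (A * B)%type.

Lemma nrm_pair x : nrm x = Num.max (nrm x.1) (nrm x.2).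
Proof.
apply: complexI; rewrite -nrmE.
have -> : `|x| = Num.max `|x.1| `|x.2| by [].
rewrite !nrmE /Order.max.
by rewrite ltr_real_complex; case: ifP.
Qed.

Lemma nrm_fst x : nrm x.1 <= nrm x.
Proof. by rewrite nrm_pair le_max lexx. Qed.

Lemma nrm_snd x : nrm x.2 <= nrm x.
Proof. by rewrite nrm_pair le_max lexx orbT. Qed.

Lemma nrm_pair_lt x (e : R) : nrm x.1 < e -> nrm x.2 < e -> nrm x < e.
Proof. by rewrite nrm_pair gt_max => -> ->. Qed.

End PairNorm.

Section Closure.
Variables (R : realType) (A : cstarAlgType R).
Implicit Types (S : set A) (x y : A).

Lemma nrmN x : nrm (- x) = nrm x.
Proof. by apply: complexI; rewrite -!nrmE normrN. Qed.

Lemma nrm_distC x y : nrm (x - y) = nrm (y - x).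
Proof. by rewrite -nrmN opprB. Qed.

Lemma nrm_dist_triangle y x z : nrm (x - z) <= nrm (x - y) + nrm (y - z).
Proof. by apply: le_trans (nrmD _ _); rewrite addrA subrK. Qed.

Lemma closure_nrmP S x :
  closure S x <-> forall e : R, 0 < e -> exists2 y, S y & nrm (x - y) < e.
Proof.
split=> [xS e e0|H V /nbhs_ballP[e /= e0 eV]].
  have eC : 0 < e%:C :> R[i] by rewrite ltr_real_complex.
  have [y [Sy]] := xS _ (nbhsx_ballx x _ eC).
  rewrite -ball_normE /ball_ /= nrmE ltr_real_complex => xy.
  by exists y.
have eR : e = (Re e)%:C by rewrite RRe_real// gtr0_real.
have [y Sy xy] : exists2 y, S y & nrm (x - y) < Re e.
  by apply: H; rewrite -ltr_real_complex -eR.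
exists y; split=> //; apply: eV; rewrite -ball_normE /ball_ /= nrmE eR.
by rewrite ltr_real_complex.
Qed.

Lemma closure_cstar_subalgebra S : S 0 ->
  (forall x y, S x -> S y -> S (x + y)) ->
  (forall (a : R[i]) x, S x -> S (a *: x)) ->
  (forall x y, S x -> S y -> S (x ** y)) ->
  (forall x, S x -> S x^**) ->
  cstar_subalgebra (closure S).
Proof.
move=> S0 SD SZ SM SS; split; last exact: closed_closure.
split=> [|x y /closure_nrmP Hx /closure_nrmP Hy|a x /closure_nrmP Hx
  |x y /closure_nrmP Hx /closure_nrmP Hy|x /closure_nrmP Hx].
- exact: subset_closure.
- apply/closure_nrmP => e e0; have e20 : 0 < e / 2 by rewrite divr_gt0.
  have [x' Sx xx] := Hx _ e20; have [y' Sy yy] := Hy _ e20.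
  exists (x' + y'); first exact: SD.
  rewrite opprD addrACA [e]splitr; apply: le_lt_trans (nrmD _ _) _.
  by rewrite ltrD.
- apply/closure_nrmP => e e0.
  have a0 : 0 < normc a + 1 by rewrite ltr_wpDl// normc_ge0.
  have [x' Sx xx] := Hx _ (divr_gt0 e0 a0).
  exists (a *: x'); first exact: SZ.
  rewrite -scalerBr nrmZ; move: xx; rewrite ltr_pdivlMr// mulrC.
  by apply: le_lt_trans; rewrite ler_wpM2r ?nrm_ge0// lerDl.
- apply/closure_nrmP => e e0; pose C := nrm x + nrm y + 1.
  have C1 : 1 <= C by rewrite /C lerDr addr_ge0 ?nrm_ge0.
  have C0 : 0 < C by apply: lt_le_trans C1.
  pose d := Num.min (e / (2 * C)) 1.
  have d0 : 0 < d by rewrite lt_min ltr01 divr_gt0 ?mulr_gt0.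
  have [dC d1] : d * (2 * C) <= e /\ d <= 1.
    by rewrite -ler_pdivlMr ?mulr_gt0// /d; split; rewrite ge_min lexx ?orbT.
  have [x' Sx xx] := Hx _ d0; have [y' Sy yy] := Hy _ d0.
  exists (x' ** y'); first exact: SM.
  have -> : x ** y - x' ** y' = (x - x') ** y + x' ** (y - y').
    by rewrite cmulDl cmulDr cmulNl cmulNr addrA subrK.
  have x'C : nrm x' <= nrm x + 1.
    rewrite -[x'](subKr x); apply: le_trans (nrmD _ _) _; rewrite nrmN lerD2l.
    exact: le_trans (ltW xx) d1.
  apply: le_lt_trans (nrmD _ _) _; apply: lt_le_trans dC.
  have h1 : nrm ((x - x') ** y) <= d * nrm y.
    by apply: le_trans (nrmM _ _) _; rewrite ler_wpM2r ?nrm_ge0// ltW.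
  have h2 : nrm (x' ** (y - y')) <= (nrm x + 1) * d.
    by apply: le_trans (nrmM _ _) _; rewrite ler_pM ?nrm_ge0// ltW.
  have := nrm_ge0 x; have := nrm_ge0 y; rewrite /C; nra.
- apply/closure_nrmP => e e0; have [x' Sx xx] := Hx _ e0.
  exists x'^**; first exact: SS.
  by rewrite -starN -starD nrm_star.
Qed.

End Closure.

Lemma natSinv_lt_eventually (R : realType) (e : R) : 0 < e ->
  exists N, forall n, (N <= n)%N -> (n.+1%:R)^-1 < e.
Proof.
move=> e0; exists (Num.bound e^-1) => n Nn.
rewrite -[e]invrK ltf_pV2 ?posrE ?invr_gt0//.
apply: lt_le_trans (archi_boundP _) _; first by rewrite invr_ge0 ltW.
by rewrite ler_nat ltnW.
Qed.

(** * From a norm bound on a generated algebra to a map having it as graph *)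

Section BoundedGraph.
Variables (R : realType) (A B : cstarAlgType R) (Q : A) (Q' : B) (K : R).
Local Notation AB := (A * B)%type.
Local Notation G := (cstar_generated ((Q, Q') : AB)).
Hypothesis K0 : 0 <= K.
Hypothesis GK : forall x : AB, G x -> nrm x.2 <= K * nrm x.1.

Let G0 : G 0.
Proof. by have [[]] := cstar_generatedP ((Q, Q') : AB). Qed.
Let GD (x y : AB) : G x -> G y -> G (x + y).
Proof. by have [[_ + _ _ _] _] := cstar_generatedP ((Q, Q') : AB); apply. Qed.
Let GZ (a : R[i]) (x : AB) : G x -> G (a *: x).
Proof. by have [[_ _ + _ _] _] := cstar_generatedP ((Q, Q') : AB); apply. Qed.
Let GM (x y : AB) : G x -> G y -> G (x ** y).
Proof. by have [[_ _ _ + _] _] := cstar_generatedP ((Q, Q') : AB); apply. Qed.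
Let GS (x : AB) : G x -> G x^**.
Proof. by have [[_ _ _ _ +] _] := cstar_generatedP ((Q, Q') : AB); apply. Qed.
Let Gc : closed G.
Proof. by have [_] := cstar_generatedP ((Q, Q') : AB). Qed.
Let GB (x y : AB) : G x -> G y -> G (x - y).
Proof. by move=> Gx Gy; rewrite -(scaleN1r y); apply: GD => //; apply: GZ. Qed.

Let G_generator : G (Q, Q').
Proof. by move=> S [_ SQ]; apply: SQ. Qed.

(** The bound applies to the difference (0, b - b') and forces it to vanish. *)
Let G_fun (a : A) (b b' : B) : G (a, b) -> G (a, b') -> b = b'.
Proof.
move=> h h'; have := GK (GB h h'); rewrite /= subrr nrm0 mulr0 => bb.
apply/eqP; rewrite -subr_eq0; apply/eqP/nrm_eq0/eqP.
by rewrite eq_le bb nrm_ge0.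
Qed.

Let dom : set A := [set a | exists b, G (a, b)].

(** Along approximants of a point of the closure, the bound makes the second components Cauchy;
    completeness of [B] and closedness of the graph provide a value at the limit. Hence the domain
    is a C*-subalgebra, and it contains everything that [Q] generates. *)
Let dom_closed : closed dom.
Proof.
move=> a /closure_nrmP Ha.
have inv0 n : 0 < (n.+1%:R)^-1 :> R by rewrite invr_gt0.
have /choice[u uP] : forall n, exists ab : AB,
    G ab /\ nrm (a - ab.1) < (n.+1%:R)^-1.
  by move=> n; have [a' [b Gab] aa] := Ha _ (inv0 n); exists (a', b).
pose v n := (u n).2.
have v_cauchy : cauchy (v @ \oo).
  apply/cauchyP => e e0.
  have eR : e = (Re e)%:C by rewrite RRe_real// gtr0_real.
  have eR0 : 0 < Re e by rewrite -ltr_real_complex -eR.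
  (* Two approximants differ by at most twice this amount, and [K] multiplies that; the added 1
     covers [K] = 0. *)
  have d0 : 0 < Re e / (2 * K + 1).
    by rewrite divr_gt0// ltr_wpDl// mulr_ge0.
  have [N NP] := natSinv_lt_eventually d0.
  exists (v N); exists N => // n /= Nn.
  rewrite -ball_normE /ball_ /= nrmE eR ltr_real_complex.
  have := GK (GB (uP N).1 (uP n).1).
  move=> /le_lt_trans; apply.
  have h m : (N <= m)%N -> nrm (a - (u m).1) < Re e / (2 * K + 1).
    by move=> Nm; apply: lt_trans (uP m).2 _; exact: NP.
  have : nrm ((u N).1 - (u n).1) <= 2 * (Re e / (2 * K + 1)).
    apply: le_trans (nrm_dist_triangle a _ _) _; rewrite nrm_distC.
    by have := h _ (leqnn N); have := h _ Nn; lra.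
  move=> /(ler_wpM2l K0)/le_lt_trans; apply.
  rewrite !mulrA ltr_pdivrMr; last by rewrite ltr_wpDl// mulr_ge0.
  by nra.
have /cvg_ex[b vb] : cvg (v @ \oo) by exact: cauchy_cvg.
exists b; apply: Gc; apply/closure_nrmP => e e0.
have eC : 0 < e%:C :> R[i] by rewrite ltr_real_complex.
have [N NP] := natSinv_lt_eventually e0.
have /cvgrPdist_lt/(_ _ eC)[M _ MP] := vb.
pose n := maxn N M; exists (u n); first by have [] := uP n.
apply: nrm_pair_lt => /=.
  by apply: lt_trans (uP n).2 _; apply: NP; rewrite /= leq_maxl.
by rewrite -ltr_real_complex -nrmE; apply: MP; rewrite /= leq_maxr.
Qed.

Lemma star_homomorphism_of_graph : exists pi : A -> B,
  star_homomorphism (cstar_generated Q) (cstar_generated Q') pi /\ pi Q = Q'.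
Proof.
have dom_sub : cstar_subalgebra dom.
  split; last exact: dom_closed.
  split=> [|x y [b Gb] [b' Gb']|a x [b Gb]|x y [b Gb] [b' Gb']|x [b Gb]].
  - by exists 0; exact: G0.
  - by exists (b + b'); exact: (GD Gb Gb').
  - by exists (a *: b); exact: (GZ a Gb).
  - by exists (b ** b'); exact: (GM Gb Gb').
  - by exists b^**; exact: (GS Gb).
have gen_dom a : a \in cstar_generated Q -> dom a.
  by move=> /set_mem; apply; split=> // _ ->; exists Q'.
(* The default 0 is taken only outside [dom], where the values of [pi] do not matter. *)
pose pi a := xget 0 [set b | G (a, b)].
have piP a : dom a -> G (a, pi a).
  by move=> [b Gb]; apply: (@xgetPex _ 0 [set b | G (a, b)]); exists b.
(* The pairs whose second component lies in the algebra generated by [Q'] form a closed *-subalgebra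
   containing the generator. *)
have G_snd a b : G (a, b) -> cstar_generated Q' b.
  pose S := [set x : AB | cstar_generated Q' x.2].
  have [[g0 gD gZ gM gS] gc] := cstar_generatedP Q'.
  suff : G `<=` S by move=> GS' /GS'.
  move=> x; apply; split; last by move=> _ -> S' [_ S'Q]; apply: S'Q.
  split; last first.
    move=> y /closure_nrmP Hy; apply: gc; apply/closure_nrmP => e e0.
    have [z Sz yz] := Hy _ e0; exists z.2 => //.
    by apply: le_lt_trans yz; exact: (nrm_snd (y - z)).
  split=> [|y z|c y|y z|y]; rewrite /S /=; [exact: g0|exact: gD|exact: gZ
    |exact: gM|exact: gS].
exists pi; split; last first.
  by apply: (@G_fun Q); [apply: piP; exists Q'; exact: G_generator|].
split=> [a /mem_set/gen_dom/piP/G_snd//|x y|x|x y|x].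
- move=> /gen_dom/piP h /gen_dom/piP h'; have H := GD h h'.
  by apply: (@G_fun (x + y) _ _ _ H); apply: piP; exists (pi x + pi y).
- move=> /gen_dom/piP h a; have H := GZ a h.
  by apply: (@G_fun (a *: x) _ _ _ H); apply: piP; exists (a *: pi x).
- move=> /gen_dom/piP h /gen_dom/piP h'; have H := GM h h'.
  by apply: (@G_fun (x ** y) _ _ _ H); apply: piP; exists (pi x ** pi y).
- move=> /gen_dom/piP h; have H := GS h.
  by apply: (@G_fun x^** _ _ _ H); apply: piP; exists (pi x)^**.
Qed.

End BoundedGraph.

(** * The 2 x 2 model *)

Section TwoByTwo.
Variable S : pzRingType.

Definition mx2 (a b c d : S) : 'M[S]_2 :=
  \matrix_(i < 2, j < 2)
    if i == 0 then (if j == 0 then a else b) else (if j == 0 then c else d).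

Lemma mx2P (M N : 'M[S]_2) : M 0 0 = N 0 0 -> M 0 1 = N 0 1 ->
  M 1 0 = N 1 0 -> M 1 1 = N 1 1 -> M = N.
Proof.
by move=> h1 h2 h3 h4; apply/matrixP => -[[|[|//]] i] [[|[|//]] j];
  [move: h1|move: h2|move: h3|move: h4]; congr (_ = _); congr (_ _ _);
  exact: val_inj.
Qed.

Lemma mx2M a b c d a' b' c' d' :
  mx2 a b c d *m mx2 a' b' c' d'
  = mx2 (a * a' + b * c') (a * b' + b * d') (c * a' + d * c') (c * b' + d * d').
Proof. by apply: mx2P; rewrite !mxE !big_ord_recl big_ord0 !mxE /= !addr0. Qed.

Lemma mx2D a b c d a' b' c' d' :
  mx2 a b c d + mx2 a' b' c' d' = mx2 (a + a') (b + b') (c + c') (d + d').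
Proof. by apply: mx2P; rewrite !mxE. Qed.

Lemma mx2Z x a b c d :
  x *: mx2 a b c d = mx2 (x * a) (x * b) (x * c) (x * d).
Proof. by apply: mx2P; rewrite !mxE. Qed.

End TwoByTwo.

Section Conjugation.
Variable R : realType.
Local Notation C := R[i].

Definition eigv : 'M[C]_2 := mx2 1 1 'i%C (- 'i%C).

Lemma adjmx_mx2 (a b c d : C) : adjmx (mx2 a b c d)
  = mx2 (conjc a) (conjc c) (conjc b) (conjc d).
Proof. by apply: mx2P; rewrite !mxE. Qed.

Lemma adjmx_eigv : adjmx eigv = mx2 1 (- 'i%C) 1 'i%C.
Proof.
rewrite adjmx_mx2; congr mx2; apply/eqP;
  by rewrite eq_complex /= ?oppr0 ?opprK !eqxx.
Qed.

Lemma eigvV : eigv *m adjmx eigv = 2%:M.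
Proof.
have ii : 'i%C * 'i%C = -1 :> C by rewrite -expr2 sqr_i.
by rewrite adjmx_eigv mx2M; apply: mx2P; rewrite !mxE /= ?mulr1n ?mulr0n;
  ring: ii.
Qed.

(* 2 (V* M V) for the unitary V = eigv / sqrt 2, whose columns are the
   eigenvectors of the skew part of every Q_r(t). *)
Definition conj_eigv (M : 'M[C]_2) : 'M[C]_2 := adjmx eigv *m M *m eigv.

Lemma conj_eigvM M N : conj_eigv M *m conj_eigv N = 2 *: conj_eigv (M *m N).
Proof.
rewrite /conj_eigv -!mulmxA (mulmxA eigv) eigvV mul_scalar_mx.
by rewrite -!scalemxAr !mulmxA.
Qed.

Lemma conj_eigvD M N : conj_eigv (M + N) = conj_eigv M + conj_eigv N.
Proof. by rewrite /conj_eigv mulmxDr mulmxDl. Qed.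

Lemma conj_eigvZ (c : C) M : conj_eigv (c *: M) = c *: conj_eigv M.
Proof. by rewrite /conj_eigv -scalemxAr -scalemxAl. Qed.

Lemma conj_eigv_adj M : conj_eigv (adjmx M) = adjmx (conj_eigv M).
Proof. by rewrite /conj_eigv !adjmxM adjmxK mulmxA. Qed.

(** All entries of [eigv] and of its adjoint have modulus 1, and each entry of the product is a sum
    of four terms. *)
Lemma normc_conj_eigv (M : 'M[C]_2) (m : R) :
  (forall i j, normc (M i j) <= m) ->
  forall i j, normc (conj_eigv M i j) <= 4 * m.
Proof.
move=> Mm i j.
have eig1 k l : normc (eigv k l) = 1.
  rewrite mxE; case: ifP => _; case: ifP => _ /=;
    by rewrite ?oppr0 ?sqrrN ?expr1n ?expr0n /= ?addr0 ?add0r sqrtr1.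
have adj1 k l : normc (adjmx eigv k l) = 1.
  rewrite !mxE; case: ifP => _; case: ifP => _ /=;
    by rewrite ?oppr0 ?opprK ?sqrrN ?expr1n ?expr0n /= ?addr0 ?add0r sqrtr1.
rewrite /conj_eigv mxE.
apply: le_trans (normc_sum _ _) _.
have -> : 4 * m = \sum_(k < 2) 2 * m.
  by rewrite sumr_const card_ord -mulr_natl; ring.
apply: ler_sum => k _; rewrite normcM eig1 mulr1 mxE.
apply: le_trans (normc_sum _ _) _.
have -> : 2 * m = \sum_(l < 2) m by rewrite sumr_const card_ord mulr_natl.
by apply: ler_sum => l _; rewrite normcM adj1 mul1r Mm.
Qed.

(** This is P(w) + Z S(w) for w = diag(l, -l) and Z with zero diagonal and both other entries m, the
    shape these two take in the eigenbasis of w. *)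
Definition model (P S : {poly C}) (l m : C) : 'M[C]_2 :=
  mx2 P.[l] (m * S.[- l]) (m * S.[l]) P.[- l].

(** These two are the components of (P + Z S)(P' + Z S') after Z is moved to the left by P(w) Z = Z
    P(-w) and Z^2 is replaced by 1 + w^2. *)
Definition uform_mul1 (P S P' S' : {poly C}) : {poly C} :=
  P * P' + (1 + 'X * 'X) * (S \Po (- 'X)) * S'.
Definition uform_mul2 (P S P' S' : {poly C}) : {poly C} :=
  S * P' + (P \Po (- 'X)) * S'.

Lemma modelM P S P' S' l m : m * m = 1 + l * l ->
  model P S l m *m model P' S' l m
  = model (uform_mul1 P S P' S') (uform_mul2 P S P' S') l m.
Proof.
move=> mm; rewrite /model mx2M /uform_mul1 /uform_mul2.
rewrite !(hornerD, hornerM, horner_comp, hornerN, hornerX, opprK, hornerC).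
by congr mx2; ring: mm.
Qed.

Lemma modelD P S P' S' l m :
  model P S l m + model P' S' l m = model (P + P') (S + S') l m.
Proof. by rewrite /model mx2D !hornerD !mulrDr. Qed.

Lemma modelZ c P S l m : c *: model P S l m = model (c *: P) (c *: S) l m.
Proof. by rewrite /model mx2Z !hornerZ; congr mx2; rewrite mulrCA. Qed.

Lemma model_adj P S (l m : R) :
  adjmx (model P S l%:C m%:C)
  = model (map_poly conjc P) (map_poly conjc S \Po (- 'X)) l%:C m%:C.
Proof.
have hc (T : {poly C}) (x : R) : (map_poly conjc T).[x%:C] = conjc T.[x%:C].
  by rewrite -[in LHS](_ : conjc x%:C = x%:C) ?horner_map//= oppr0.
rewrite adjmx_mx2 /model !horner_comp !hornerN !hornerX opprK -!rmorphN /= !hc.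
by congr mx2; rewrite [LHS]rmorphM /= oppr0.
Qed.

End Conjugation.

(** * The *-algebra of elements P(w) + Z S(w) *)

Section UnitizationForm.
Variables (R : realType) (B : cstarAlgType R).
Local Notation U := (unitization B).
Variable E : U.
Hypothesis Eidem : E * E = E.
Local Notation w := (skew_part E).
Local Notation Z := (sym_part E).
Local Notation ev := (horner_alg w).
Implicit Types P S : {poly R[i]}.

Definition uform P S : U := ev P + Z * ev S.

Lemma horner_sym P : ev P * Z = Z * ev (P \Po (- 'X)).
Proof.
elim/poly_ind: P => [|P c IH]; first by rewrite comp_poly0 rmorph0 mul0r mulr0.
rewrite comp_polyD comp_polyM comp_polyX comp_polyC !rmorphD !rmorphM /=.
rewrite rmorphN /= !horner_algX !horner_algC mulrDl [RHS]mulrDr.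
congr (_ + _); last by rewrite -scalerAl mul1r -scalerAr mulr1.
by rewrite -mulrA -[w * Z]opprK -sym_skew_anticomm// mulrN mulrA IH mulrA mulrN.
Qed.

Lemma uformM P S P' S' :
  uform P S * uform P' S' = uform (uform_mul1 P S P' S') (uform_mul2 P S P' S').
Proof.
rewrite /uform /uform_mul1 /uform_mul2.
have wX : w = ev 'X by rewrite horner_algX.
have := sym_part_sqr Eidem; move: Z horner_sym => z zc zz.
rewrite mulrDl [ev P * _]mulrDr [z * ev S * _]mulrDr !mulrA zc.
rewrite -(mulrA z (ev S) z) zc !mulrA zz !addrA [LHS](ACl (1*4*3*2)) /=.
rewrite !(rmorphD ev) !(rmorphM ev) /= rmorphD rmorph1 rmorphM /= -wX.
by rewrite [z * (_ + _)]mulrDr !mulrA !addrA.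
Qed.

Lemma uformD P S P' S' : uform P S + uform P' S' = uform (P + P') (S + S').
Proof. by rewrite /uform !rmorphD /= mulrDr addrACA. Qed.

Lemma uformZ c P S : c *: uform P S = uform (c *: P) (c *: S).
Proof.
rewrite /uform scalerDr scalerAr -!mul_polyC !(rmorphM ev) /= !horner_algC.
by rewrite !mulr_algl.
Qed.

Lemma uform_star P S :
  ustar (uform P S) = uform (map_poly conjc P) (map_poly conjc S \Po (- 'X)).
Proof.
rewrite ustarD ustarM !(ustar_horner (skew_part_star E)) sym_part_star.
by rewrite horner_sym.
Qed.

(** Each summand is estimated by the C*-identity: (Z S(w))* Z S(w) has 1 + w^2 in its middle, whence
    the weight 1 + x^2, and adding the two bounds gives the factor 2. *)
Lemma unorm_uform_le P S (rho M : R) : unorm w <= rho ->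
  (forall x, `|x| <= rho -> normc P.[x%:C] <= M) ->
  (forall x, `|x| <= rho -> (1 + x ^+ 2) * normc S.[x%:C] ^+ 2 <= M ^+ 2) ->
  unorm (uform P S) <= 2 * M.
Proof.
move=> wr PM SM; have ws := skew_part_star E.
have rho0 : 0 <= rho by apply: le_trans (unorm_ge0 _) wr.
have M0 : 0 <= M.
  by apply: le_trans (PM 0 _); rewrite ?normr0 ?normc_ge0.
have hP : unorm (ev P) <= M.
  rewrite -(@ler_pXn2r _ 2)// ?nnegrE ?unorm_ge0//.
  apply: le_trans (unorm_starM_ge _) _; rewrite ustar_horner// -rmorphM /=.
  have := @unorm_horner_normsq_le _ _ _ ws rho (M ^+ 2) 1 P wr.
  rewrite rmorph1 mulr1; apply=> x xr.
  rewrite hornerC mul1r ger0_norm ?sqr_ge0//.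
  by rewrite ler_pXn2r ?nnegrE ?normc_ge0 ?PM.
have hS : unorm (Z * ev S) <= M.
  rewrite -(@ler_pXn2r _ 2)// ?nnegrE ?unorm_ge0//.
  apply: le_trans (unorm_starM_ge _) _.
  rewrite ustarM sym_part_star mulrA -(mulrA _ Z Z) sym_part_sqr//.
  rewrite ustar_horner//.
  have -> : 1 + w * w = ev (map_poly (real_complex R) (1 + 'X * 'X)).
    by rewrite rmorphD rmorphM rmorph1 /= map_polyX rmorphD rmorph1 rmorphM
      /= horner_algX.
  rewrite -!rmorphM /=.
  apply: (@unorm_horner_normsq_le _ _ _ ws rho) => // x xr.
  rewrite hornerD hornerC hornerM hornerX -expr2 ger0_norm ?SM//.
  by rewrite mulr_ge0 ?addr_ge0 ?sqr_ge0.
by apply: le_trans (unormD _ _) _; rewrite mulr_natl mulr2n lerD.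
Qed.

End UnitizationForm.

(** * The universal idempotent *)

Lemma d_ofE (R : realType) (r : R) : 2 * d_of r = r + 1.
Proof. by rewrite /d_of; field. Qed.

Section Model.
Variables (R : realType) (r : R).
Hypothesis r1 : 1 < r.
Local Notation T := (set_type `[1, d_of r]%classic).
Local Notation M := (cmx 1 (d_of r) 2).

Lemma cmx_eval_mul (x y : M) t :
  cmx_eval (x ** y) t = cmx_eval x t *m cmx_eval y t.
Proof. exact: cmx_evalM. Qed.

Lemma cmx_eval_adj (x : M) t : cmx_eval x^** t = adjmx (cmx_eval x t).
Proof. exact: cmx_eval_star. Qed.

Lemma nrm_cmx (x : M) : nrm x = cmx_norm x.
Proof. by apply: complexI; rewrite -nrmE cmx_normE. Qed.

Definition ell (t : R) : R := Num.sqrt (t * (t - 1)).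

Lemma ell_sqr (t : R) : 1 <= t -> ell t ^+ 2 = t * (t - 1).
Proof.
by move=> t1; rewrite sqr_sqrtr// mulr_ge0 ?subr_ge0// (le_trans ler01).
Qed.

Lemma T_ge1 (t : T) : 1 <= val t <= d_of r.
Proof. by case: t => t /= /set_mem; rewrite /= in_itv. Qed.

Lemma Q_matrix_eval (t : T) : cmx_eval (Q_matrix r) t =
  mx2 (val t)%:C (- (ell (val t))%:C) (ell (val t))%:C (1 - val t)%:C.
Proof. by apply: mx2P; rewrite !mxE //= rmorphB. Qed.

Lemma Q_matrix_idem : Q_matrix r ** Q_matrix r = Q_matrix r.
Proof.
apply: cmx_evalP => t; rewrite cmx_eval_mul Q_matrix_eval mx2M.
have /andP[t1 _] := T_ge1 t; have := ell_sqr t1; set s := val t => ls.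
have lsC : (ell s)%:C * (ell s)%:C = s%:C * (s%:C - 1) :> R[i].
  by rewrite -rmorphM /= -expr2 ls rmorphM rmorphB.
by rewrite rmorphB rmorph1; congr mx2; ring: lsC.
Qed.

Lemma sqr_l2norm2 (v : 'cV[R[i]]_2) : l2norm v ^+ 2
  = Re (v 0 0) ^+ 2 + Im (v 0 0) ^+ 2 + (Re (v 1 0) ^+ 2 + Im (v 1 0) ^+ 2).
Proof.
have nc (z : R[i]) : normc z ^+ 2 = Re z ^+ 2 + Im z ^+ 2.
  by case: z => a b; rewrite /= sqr_sqrtr// addr_ge0 ?sqr_ge0.
rewrite l2norm_sqr !big_ord_recl big_ord0 addr0 !nc.
by congr (_ + (Re (v _ _) ^+ 2 + Im (v _ _) ^+ 2)); exact: val_inj.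
Qed.

(** The identity exhibits 2s - 1 as the norm: each subtracted form, multiplied by s, is a perfect
    square because l^2 = s (s - 1). *)
Lemma Q_matrix_apply (t : T) (v : 'cV[R[i]]_2) (s := val t) (l := ell (val t)) :
  l2norm (cmx_eval (Q_matrix r) t *m v) ^+ 2 =
  (2 * s - 1) ^+ 2 * l2norm v ^+ 2
  - (2 * s - 1) * ((s - 1) * Re (v 0 0) ^+ 2
      + 2 * l * Re (v 0 0) * Re (v 1 0) + s * Re (v 1 0) ^+ 2)
  - (2 * s - 1) * ((s - 1) * Im (v 0 0) ^+ 2
      + 2 * l * Im (v 0 0) * Im (v 1 0) + s * Im (v 1 0) ^+ 2).
Proof.
have /andP[t1 _] := T_ge1 t; have ls : l ^+ 2 = s * (s - 1) by exact: ell_sqr.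
rewrite !sqr_l2norm2 Q_matrix_eval -/s -/l !mxE !big_ord_recl !big_ord0.
rewrite !mxE /= !addr0.
have -> : lift (ord0 : 'I_2) ord0 = 1 by exact: val_inj.
case: (v _ _) => a b; case: (v _ _) => c e; simpc => /=.
by ring: ls.
Qed.

Lemma opnorm_Q_matrix (t : T) :
  opnorm (cmx_eval (Q_matrix r) t) = 2 * val t - 1.
Proof.
have /andP[t1 _] := T_ge1 t.
have := Q_matrix_apply t; have := ell_sqr t1.
set s := val t in t1 *; set l := ell s => ls HQ.
have s0 : 0 < s by apply: lt_le_trans t1.
have s21 : 0 <= 2 * s - 1 by lra.
apply/eqP; rewrite eq_le; apply/andP; split.
  apply: opnorm_le => v v1.
  apply: le_trans (_ : (2 * s - 1) * l2norm v <= _); last first.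
    by rewrite ler_piMr.
  rewrite -(@ler_pXn2r _ 2)// ?nnegrE ?l2norm_ge0 ?mulr_ge0 ?l2norm_ge0//.
  rewrite HQ exprMn.
  have pos a c : 0 <= (s - 1) * a ^+ 2 + 2 * l * a * c + s * c ^+ 2.
    rewrite -(pmulr_rge0 _ s0).
    have -> : s * ((s - 1) * a ^+ 2 + 2 * l * a * c + s * c ^+ 2)
        = (s * c + l * a) ^+ 2 by ring: ls.
    exact: sqr_ge0.
  have := mulr_ge0 s21 (pos (Re (v 0 0)) (Re (v 1 0))).
  have := mulr_ge0 s21 (pos (Im (v 0 0)) (Im (v 1 0))).
  by lra.
(* At the vector (s, -l) both subtracted forms vanish, so the bound is attained. *)
pose v : 'cV[R[i]]_2 := \col_i (if i == 0 then s%:C else - l%:C).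
have := HQ v; rewrite !mxE /= oppr0.
rewrite (_ : _ + s * _ = 0); last by ring: ls.
rewrite (_ : _ + s * 0 ^+ 2 = 0); last by ring.
rewrite !mulr0 !subr0 -exprMn => /eqP.
rewrite eqrXn2// ?mulr_ge0 ?l2norm_ge0// => /eqP Mv.
have v0 : 0 < l2norm v.
  apply: lt_le_trans (normc_le_l2norm v 0).
  by rewrite mxE /= expr0n addr0 sqrtr_sqr ger0_norm// ltW.
by rewrite -(ler_pM2r v0) -Mv l2norm_mulmx_opnorm.
Qed.

Let d1 : 1 < d_of r. Proof. by have := d_ofE r; move: r1; lra. Qed.

Definition point_of (t : R) (ht : 1 <= t <= d_of r) : T.
Proof. by exists t; rewrite inE /= in_itv. Defined.

Lemma cmx_norm_Q_matrix : cmx_norm (Q_matrix r) = r.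
Proof.
have d1d : 1 <= d_of r <= d_of r by rewrite lexx ltW.
have r0 : 0 <= r by apply: le_trans (ltW r1).
apply/eqP; rewrite eq_le; apply/andP; split.
  apply: cmx_norm_le => // t; rewrite opnorm_Q_matrix.
  have /andP[_] := T_ge1 t; have := d_ofE r; lra.
apply: le_trans (opnorm_cmx_le _ (point_of d1d)).
by rewrite opnorm_Q_matrix /=; have := d_ofE r; lra.
Qed.

Lemma Q_norm : `|Q_ r| = r%:C.
Proof.
rewrite nrmE; congr (_%:C); rewrite !nrm_pair /= nrm_cmx cmx_norm_Q_matrix.
have -> : nrm (1 : R[i]) = 1 by apply: complexI; rewrite -nrmE normr1.
by rewrite nrm0 (@max_l _ _ 1 0) ?ler01// max_r ?(ltW r1).
Qed.

Lemma Q_non_projection : non_projection_idempotent (Q_ r).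
Proof.
have Qid : idempotent_elt (Q_ r).
  congr (_, _, _) => //; first exact: mulr1.
  exact: Q_matrix_idem.
split=> // -[_ /(congr1 snd)/= Qs].
(* At the right endpoint the off-diagonal entries are nonzero and opposite, so the matrix is not
   self-adjoint. *)
have d1d : 1 <= d_of r <= d_of r by rewrite lexx ltW.
have := cmx_eval_adj (Q_matrix r) (point_of d1d).
rewrite Qs Q_matrix_eval adjmx_mx2 => /matrixP/(_ 0 1).
rewrite !mxE /= => /(congr1 (@Re R)) /=.
have : 0 < ell (d_of r).
  by rewrite sqrtr_gt0 mulr_gt0 ?subr_gt0// (lt_trans ltr01).
by lra.
Qed.

(** In the basis [eigv], w(t) becomes diag([lam t], -[lam t]), and Z(t) has zero diagonal and both
    other entries [mu t]. *)
Definition lam (t : T) : R := 2 * ell (val t).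
Definition mu (t : T) : R := 2 * val t - 1.

Lemma mu_sqr t : (mu t)%:C * (mu t)%:C = 1 + (lam t)%:C * (lam t)%:C :> R[i].
Proof.
have /andP[t1 _] := T_ge1 t.
rewrite -!rmorphM -(rmorph1 (real_complex R)) -rmorphD /=; congr (_%:C).
by have := ell_sqr t1; rewrite /mu /lam => ls; ring: ls.
Qed.

(** The parameter solves 2t - 1 = sqrt(1 + s^2), and it is at most d because 1 + s^2 <= r^2. With
    both signs of the eigenvalue, the whole interval of the norm estimate is thus visible in the
    model. *)
Lemma lam_mu_surj (s : R) : 0 <= s <= Num.sqrt (r ^+ 2 - 1) ->
  exists t, lam t = s /\ mu t ^+ 2 = 1 + s ^+ 2.
Proof.
move=> /andP[s0 sr]; pose t := (1 + Num.sqrt (1 + s ^+ 2)) / 2.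
have q0 : 0 <= 1 + s ^+ 2 by rewrite addr_ge0 ?sqr_ge0.
have qq : Num.sqrt (1 + s ^+ 2) ^+ 2 = 1 + s ^+ 2 by rewrite sqr_sqrtr.
have tt : 1 <= t <= d_of r.
  rewrite /t; apply/andP; split.
    have : 1 <= Num.sqrt (1 + s ^+ 2).
      by rewrite -{1}(@sqrtr1 R) ler_wsqrtr// lerDl sqr_ge0.
    by lra.
  have : Num.sqrt (1 + s ^+ 2) <= r.
    have r0 : 0 <= r by apply: le_trans (ltW r1).
    rewrite -(@ler_pXn2r _ 2)// ?nnegrE ?sqrtr_ge0// qq.
    have : s ^+ 2 <= Num.sqrt (r ^+ 2 - 1) ^+ 2.
      by rewrite ler_pXn2r ?nnegrE ?sqrtr_ge0.
    rewrite sqr_sqrtr; first by lra.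
    by rewrite subr_ge0 exprn_ege1// ltW.
  by have := d_ofE r; lra.
exists (point_of tt); rewrite /lam /mu (_ : val (point_of tt) = t)//; split.
  rewrite /ell (_ : t * (t - 1) = (s / 2) ^+ 2).
    by rewrite sqrtr_sqr ger0_norm ?divr_ge0 ?ler0n //; field.
  have -> : t * (t - 1) = (Num.sqrt (1 + s ^+ 2) ^+ 2 - 1) / 4.
    by rewrite /t; field.
  by rewrite qq; field.
by rewrite -qq /t; field.
Qed.

Variables (B : cstarAlgType R) (Q' : B).
Hypothesis Q'idem : idempotent_elt Q'.
Hypothesis Q'r : nrm Q' <= r.
Local Notation A := (R[i] * zero_algebra R * M)%type.
Local Notation AB := (A * B)%type.
Local Notation E := (uinj Q').

Let Eidem : E * E = E.
Proof. by rewrite -uinjM Q'idem. Qed.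

(** The same polynomials describe both coordinates, which is what makes their norms comparable. The
    factor 2 comes from [eigv] being sqrt 2 times a unitary. *)
Definition modelled : set AB := [set x | exists P S,
  uinj x.2 = uform E P S /\
  forall t, conj_eigv (cmx_eval x.1.2 t) = 2 *: model P S (lam t)%:C (mu t)%:C].

Let modelled0 : modelled 0.
Proof.
exists 0, 0; split=> [|t]; first by rewrite /uform !rmorph0 mulr0 addr0.
have -> : cmx_eval ((0 : AB).1.2) t = 0 by apply/matrixP => i j; rewrite !mxE.
rewrite /conj_eigv mulmx0 mul0mx; apply: mx2P; rewrite !mxE /= !horner0;
  by rewrite ?mulr0.
Qed.

Let modelledD x y : modelled x -> modelled y -> modelled (x + y).
Proof.
move=> [P [S [xE xm]]] [P' [S' [yE ym]]]; exists (P + P'), (S + S').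
split=> [|t]; first by rewrite uinjD xE yE uformD.
by rewrite cmx_evalD conj_eigvD xm ym -scalerDr modelD.
Qed.

Let modelledZ (a : R[i]) x : modelled x -> modelled (a *: x).
Proof.
move=> [P [S [xE xm]]]; exists (a *: P), (a *: S).
split=> [|t]; first by rewrite uinjZ xE uformZ.
by rewrite cmx_evalZ conj_eigvZ xm -modelZ !scalerA mulrC.
Qed.

Let modelledM x y : modelled x -> modelled y -> modelled (x ** y).
Proof.
move=> [P [S [xE xm]]] [P' [S' [yE ym]]].
exists (uform_mul1 P S P' S'), (uform_mul2 P S P' S').
split=> [|t]; first by rewrite uinjM xE yE uformM.
have two0 : 2 != 0 :> R[i] by rewrite pnatr_eq0.
apply: (scalerI two0); rewrite cmx_eval_mul -conj_eigvM xm ym.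
by rewrite -scalemxAl -scalemxAr modelM// mu_sqr.
Qed.

Let modelledS x : modelled x -> modelled x^**.
Proof.
move=> [P [S [xE xm]]].
exists (map_poly conjc P), (map_poly conjc S \Po (- 'X)).
split=> [|t]; first by rewrite uinj_star xE uform_star.
rewrite cmx_eval_adj conj_eigv_adj xm -model_adj.
by apply/matrixP => i j; rewrite !mxE rmorphM rmorph_nat.
Qed.

Let modelled_generator : modelled (Q_ r, Q').
Proof.
(* These are the coefficients in E = (1 + Z - iw) / 2. *)
exists ((2^-1)%:C *: (1 - 'i%C *: 'X)), ((2^-1)%:C%:P); split=> [|t] /=.
  rewrite [LHS](idem_decomp E) /uform horner_algC.
  rewrite -mul_polyC (rmorphM (horner_alg _)) /= horner_algC mulr_algl.
  rewrite rmorphB rmorph1 /= -mul_polyC (rmorphM (horner_alg _)) /= horner_algC.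
  rewrite horner_algX mulr_algl -scalerAr mulr1 -scalerDr; congr (_ *: _).
  by rewrite addrAC.
have ii : 'i%C * 'i%C = -1 :> R[i] by rewrite -expr2 sqr_i.
have half : (2^-1)%:C * 2 = 1 :> R[i].
  by apply/eqP; rewrite eq_complex /=; apply/andP; split; apply/eqP; field.
rewrite Q_matrix_eval /conj_eigv adjmx_eigv /eigv !mx2M /model mx2Z.
rewrite !hornerZ !hornerD !hornerN !hornerZ !hornerX !hornerC.
rewrite /mu /lam !rmorphB !rmorphM /= !rmorph1 (rmorph_nat (real_complex R) 2).
have h2 (z : R[i]) : 2 * ((2^-1)%:C * z) = z.
  by rewrite mulrA [2 * _]mulrC half mul1r.
have h3 (z : R[i]) : 2 * (z * (2^-1)%:C) = z by rewrite [z * _]mulrC h2.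
by congr mx2; rewrite ?h2 ?h3; ring: ii.
Qed.

(** Conjugation bounds the entries of twice the model by 4m, hence those of the model by 2m; the two
    summands of [uform] contribute the remaining factor 2. *)
Lemma modelled_bound x : modelled x -> nrm x.2 <= 4 * nrm x.1.
Proof.
move=> [P [S [xE xm]]]; apply: le_trans (unorm_inj_ge _) _; rewrite xE.
set m := nrm x.1.
have Mm (i j : 'I_2) t : normc (model P S (lam t)%:C (mu t)%:C i j) <= 2 * m.
  have Xm k l : normc (cmx_eval x.1.2 t k l) <= m.
    rewrite mxE; apply: le_trans (normc_le_cmx_norm _ _ _ _) _.
    by rewrite -nrm_cmx; exact: (nrm_snd x.1).
  have := normc_conj_eigv Xm i j; rewrite xm mxE normcM.
  rewrite (_ : normc 2 = 2); first by lra.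
  by apply: complexI; rewrite -normcR normr_nat rmorph_nat.
have mu0 t : 0 <= mu t by have /andP[] := T_ge1 t; rewrite /mu; lra.
have normcC (a : R) : normc a%:C = `|a| by rewrite /= expr0n addr0 sqrtr_sqr.
have -> : 4 * m = 2 * (2 * m) by lra.
have wr := unorm_skew_part_le Eidem r1 (le_trans (unorm_inj_le Q') Q'r).
have key s : `|s| <= Num.sqrt (r ^+ 2 - 1) -> normc P.[s%:C] <= 2 * m /\
    (1 + s ^+ 2) * normc S.[s%:C] ^+ 2 <= (2 * m) ^+ 2.
  move=> sr; have [|t [ts tm]] := @lam_mu_surj `|s|; first by rewrite normr_ge0.
  have m0 : 0 <= 2 * m by rewrite mulr_ge0 ?nrm_ge0.
  have mS z : normc ((mu t)%:C * S.[z]) <= 2 * m ->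
      (1 + `|s| ^+ 2) * normc S.[z] ^+ 2 <= (2 * m) ^+ 2.
    rewrite -tm normcM normcC ger0_norm// -exprMn => H.
    by rewrite ler_pXn2r ?nnegrE ?m0 ?mulr_ge0 ?mu0 ?normc_ge0.
  (* The first column of the model carries the values at |s|, the second those at -|s|; the sign of
     s selects the column. *)
  have := Mm 0 0 t; have := Mm 0 1 t; have := Mm 1 0 t; have := Mm 1 1 t.
  rewrite !mxE /= ts; have [s0|s0] := leP 0 s.
    rewrite !ger0_norm// in mS * => _ h1 _ h2; split=> //.
    exact: mS.
  rewrite !ltr0_norm// in mS * => h1 _ h2 _.
  rewrite -rmorphN /= opprK in h1 h2; split=> //.
  by rewrite -[s ^+ 2]sqrrN; exact: mS.
by apply: (unorm_uform_le Eidem wr) => s /key[].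
Qed.

Lemma graph_bound (x : AB) : cstar_generated ((Q_ r, Q') : AB) x ->
  nrm x.2 <= 4 * nrm x.1.
Proof.
move=> /(_ (closure modelled)) H.
have {H} /closure_nrmP H : closure modelled x.
  apply: H; split; first exact: (closure_cstar_subalgebra modelled0
    modelledD modelledZ modelledM modelledS).
  by move=> _ ->; apply: subset_closure; exact: modelled_generator.
(* Approximation costs e / 5 in the second coordinate and, through the constant 4, another 4e / 5 in
   the first. *)
apply/ler_addgt0Pr => e e0; have e5 : 0 < e / 5 by rewrite divr_gt0.
have [y /modelled_bound yb xy] := H _ e5.
have : nrm x.2 <= nrm y.2 + e / 5.
  rewrite -[x.2](subrK y.2) addrC; apply: le_trans (nrmD _ _) _.
  by rewrite lerD2l ltW// (le_lt_trans (nrm_snd (x - y))).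
have : nrm y.1 <= nrm x.1 + e / 5.
  rewrite -[y.1](subrK x.1) addrC; apply: le_trans (nrmD _ _) _.
  by rewrite lerD2l nrm_distC ltW// (le_lt_trans (nrm_fst (x - y))).
by lra.
Qed.

End Model.

Theorem theorem3p12 (R : realType) (r : R) (r_gt1 : 1 < r) :
  universal_idempotent r (Q_ r).
Proof.
split; [exact: Q_non_projection|exact: Q_norm|].
move=> B Q' [Q'id _]; rewrite nrmE ler_real_complex => Q'r.
exact: (@star_homomorphism_of_graph _ _ _ _ _ 4 _ (graph_bound r_gt1 Q'id Q'r)).
Qed.
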